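(* Let $P$ be an $n$-polyhedron, $n\ne 2$, that embeds in $S^{2n}$. Then $P$ embeds in an $(n-1)$-connected $n$-polyhedron $Q$ such that $Q$ embeds in $S^{2n}$.
   Context: Polyhedra are compact and PL; an $n$-polyhedron is a polyhedron of dimension $n$; all embeddings are piecewise linear. *)

(* Defs.v *)
From HB Require Import structures.
From mathcomp Require Import all_boot all_order all_algebra finmap.
From mathcomp Require Import all_classical all_reals all_analysis.
Set Implicit Arguments.
Unset Strict Implicit.
Unset Printing Implicit Defensive.
Import Order.TTheory GRing.Theory Num.Theory numFieldNormedType.Exports.

Local Open Scope classical_set_scope.
Local Open Scope ring_scope.

Section PiecewiseLinear.
Context {R : realType}.

(* Finite vertex sets and geometric simplices in R^N; only the values of the
   weights [w] on the vertex set [s] matter. *)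

Definition barycentric N (s : {fset 'rV[R]_N}) (w : 'rV[R]_N -> R) : Prop :=
  (forall v, v \in s -> 0 <= w v) /\ \sum_(v <- s) w v = 1.

Definition conv_hull N (s : {fset 'rV[R]_N}) : set 'rV[R]_N :=
  [set x | exists2 w, barycentric s w & x = \sum_(v <- s) w v *: v].

Definition affinely_independent N (s : {fset 'rV[R]_N}) : Prop :=
  forall w : 'rV[R]_N -> R,
    \sum_(v <- s) w v = 0 -> \sum_(v <- s) w v *: v = 0 ->
    forall v, v \in s -> w v = 0.

(* A finite geometric simplicial complex, given by the vertex sets of its
   nonempty simplices.  As [conv_hull fset0] is empty, the last clause says that
   two simplices are disjoint or meet in their common face. *)
Definition simplicial_complex N (K : {fset {fset 'rV[R]_N}}) : Prop :=
  [/\ forall s, s \in K -> s != fset0 /\ affinely_independent s,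
      forall s t, s \in K -> (t `<=` s)%fset -> t != fset0 -> t \in K &
      forall s t, s \in K -> t \in K ->
        conv_hull s `&` conv_hull t = conv_hull (s `&` t)%fset].

Definition space N (K : {fset {fset 'rV[R]_N}}) : set 'rV[R]_N :=
  [set x | exists2 s, s \in K & conv_hull s x].

Definition triangulates N (K : {fset {fset 'rV[R]_N}}) (P : set 'rV[R]_N) :
  Prop := simplicial_complex K /\ space K = P.

(* Compact polyhedra of dimension exactly n: a d-simplex has d + 1 vertices. *)
Definition n_polyhedron (n N : nat) (P : set 'rV[R]_N) : Prop :=
  exists2 K, triangulates K P & (\max_(s <- K) #|` s|)%N = n.+1.

Definition affine_on_simplex N M (f : 'rV[R]_N -> 'rV[R]_M)
    (s : {fset 'rV[R]_N}) : Prop :=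
  forall w, barycentric s w ->
    f (\sum_(v <- s) w v *: v) = \sum_(v <- s) w v *: f v.

Definition pl_on N M (P : set 'rV[R]_N) (f : 'rV[R]_N -> 'rV[R]_M) : Prop :=
  exists2 K, triangulates K P & forall s, s \in K -> affine_on_simplex f s.

(* By compactness, an injective PL map is a homeomorphism onto its image. *)
Definition pl_embedding N M (P : set 'rV[R]_N) (Q : set 'rV[R]_M)
    (f : 'rV[R]_N -> 'rV[R]_M) : Prop :=
  [/\ pl_on P f, {in P &, injective f} & f @` P `<=` Q].

Definition pl_embeds N M (P : set 'rV[R]_N) (Q : set 'rV[R]_M) : Prop :=
  exists f, pl_embedding P Q f.

(* The PL m-sphere, as the boundary of the standard (m+1)-simplex. *)
Definition pl_sphere (m : nat) : set 'rV[R]_m.+2 :=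
  [set x | [/\ forall j, 0 <= x ord0 j, \sum_j x ord0 j = 1 &
               exists j, x ord0 j = 0]].

End PiecewiseLinear.

Arguments pl_sphere R m : clear implicits.

Section Connectivity.
Context {R : realType}.

Definition unit_cube (i : nat) : set 'rV[R]_i :=
  [set u | forall j, 0 <= u ord0 j <= 1].

Definition cube_boundary (i : nat) : set 'rV[R]_i :=
  [set u | unit_cube u /\ exists j, u ord0 j = 0 \/ u ord0 j = 1].

(* Representatives of elements of pi_i(X, x0): maps (I^i, dI^i) -> (X, x0). *)
Definition spheroid i N (X : set 'rV[R]_N) (x0 : 'rV[R]_N)
    (f : 'rV[R]_i -> 'rV[R]_N) : Prop :=
  [/\ {within @unit_cube i, continuous f},
      forall u, unit_cube u -> X (f u) &
      forall u, cube_boundary u -> f u = x0].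

Definition spheroid_homotopic i N (X : set 'rV[R]_N) (x0 : 'rV[R]_N)
    (f g : 'rV[R]_i -> 'rV[R]_N) : Prop :=
  exists H : 'rV[R]_i * R -> 'rV[R]_N,
    [/\ {within @unit_cube i `*` `[0, 1], continuous H},
        forall u t, unit_cube u -> 0 <= t <= 1 -> X (H (u, t)),
        forall u, unit_cube u -> H (u, 0) = f u,
        forall u, unit_cube u -> H (u, 1) = g u &
        forall u t, cube_boundary u -> 0 <= t <= 1 -> H (u, t) = x0].

(* pi_i(X, x0) is trivial; for i = 0 this is the pointed set of path
   components. *)
Definition trivial_pi i N (X : set 'rV[R]_N) (x0 : 'rV[R]_N) : Prop :=
  forall f : 'rV[R]_i -> 'rV[R]_N,
    spheroid X x0 f -> spheroid_homotopic X x0 f (cst x0).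

(* k is an integer because (-1)-connected means nonempty. *)
Definition k_connected (k : int) N (X : set 'rV[R]_N) : Prop :=
  X !=set0 /\
  forall (i : nat) (x0 : 'rV[R]_N), i%:Z <= k -> X x0 -> trivial_pi i X x0.

End Connectivity.

(* Main.v *)
(* Cut the sphere, the boundary of a simplex, by hyperplanes containing the
   spans of the images of the simplices of P, and let T be the barycentric
   subdivision of the resulting cell complex. The image of P lies in the
   n-skeleton Q of T, so it remains to see that Q is (n-1)-connected.

   A point x of R^(2n+2) off the diagonal projects to the boundary of the
   orthant by subtracting its least coordinate. Subtracting from the weights of
   the projection in T the (n+2)-nd largest of them and normalizing the positive
   ones yields a retraction onto Q. It is undefined only where the n+2 largest
   weights coincide, which happens on finitely many linear subspaces of
   dimension n+1. The straight-line homotopy of a spheroid of dimension i < n is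
   a map from a cube of dimension at most n, so it can be perturbed off these
   subspaces, and then retracted to Q. *)

Require Import Defs.
From mathcomp Require Import all_boot all_order all_algebra finmap.
From mathcomp Require Import all_classical all_reals all_analysis.
From mathcomp Require Import lra zify.
Set Implicit Arguments.
Unset Strict Implicit.
Unset Printing Implicit Defensive.
Import Order.TTheory GRing.Theory Num.Theory numFieldNormedType.Exports.

Local Open Scope classical_set_scope.
Local Open Scope ring_scope.

(** * Maps between spaces of row vectors *)

Section RowVectors.
Context {R : realType}.

(** The argument is linear algebra in the cone over the sphere. Each point of the cone is a unique
    nonnegative combination of a chain of vertices. From these weights it follows that the
    subdivision is a simplicial complex, that its vertices on a proper subspace form short chains,
    and that the retraction is continuous.

    The dimension of [P] is known from one triangulation, while the embedding is affine on the
    simplices of another. No common subdivision is formed: for each pair of simplices, one of each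
    kind, the hyperplanes cut out a subspace of dimension at most n + 1 that contains the image of
    their intersection.

    The perturbation has to fix the ends and the sides of the homotopy, where it already lies in the
    skeleton. The total weight left after truncation is 1 on the skeleton and 0 exactly where the
    retraction is undefined, so it serves as the cutoff that switches the perturbation on. *)

Lemma row_norm_le d (x : 'rV[R]_d) (c : R) :
  0 <= c -> (forall j, `|x ord0 j| <= c) -> `|x| <= c.
Proof.
move=> c0 xc; rewrite [leLHS]/Num.Def.normr /= mx_normrE; apply/bigmax_leP; split=> //.
by move=> [i j] _ /=; rewrite ord1.
Qed.

Lemma coord_le_norm d (x : 'rV[R]_d) j : `|x ord0 j| <= `|x|.
Proof.
rewrite [leRHS]/Num.Def.normr /= mx_normrE; apply/bigmax_geP; right => /=.
by exists (ord0, j).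
Qed.

Lemma continuous_row d (T : topologicalType) (f : T -> 'rV[R]_d) :
  (forall j, continuous (fun x => f x ord0 j)) -> continuous f.
Proof.
move=> fc x; apply/cvgrPdist_le => e e0.
have : \forall y \near x, forall j, `|f x ord0 j - f y ord0 j| <= e.
  apply: filter_forall => j.
  by move/cvgrPdist_le : (fc j x); apply.
apply: filterS => y H; apply: row_norm_le; first exact: ltW.
by move=> j; rewrite !mxE.
Qed.

Lemma row_continuous_lincomb d (T : topologicalType) (I : Type) (r : seq I)
    (a : I -> T -> R) (v : I -> 'rV[R]_d) :
  (forall i, continuous (a i)) ->
  continuous (fun x => \sum_(i <- r) a i x *: v i).
Proof.
move=> ac; apply: continuous_big => [|i _ x]; first exact: add_continuous.
exact: cvgZr_tmp (ac i x).
Qed.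

Lemma mulmx_lipschitz m d (M : 'M[R]_(m, d)) :
  exists2 C : R, 0 <= C & forall p : 'rV[R]_m, `|p *m M| <= C * `|p|.
Proof.
exists (\sum_i `|row i M|) => [|p]; first by apply: sumr_ge0.
rewrite mulmx_sum_row mulr_suml; apply: le_trans (ler_norm_sum _ _ _) _.
apply: ler_sum => i _; rewrite normrZ mulrC ler_wpM2l //.
exact: coord_le_norm.
Qed.

Lemma lipschitz_continuous (U V : normedModType R) (f : U -> V) (C : R) :
  (forall u v, `|f u - f v| <= C * `|u - v|) -> continuous f.
Proof.
move=> fL x; apply/cvgrPdist_lt => e e0.
have C1 : 0 < `|C| + 1 by apply: ltr_wpDl.
apply/nbhs_normP; exists (e / (`|C| + 1)) => /=; first exact: divr_gt0.
move=> y /= xy.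
apply: le_lt_trans (fL _ _) _.
rewrite ltr_pdivlMr // in xy; apply: le_lt_trans xy; rewrite mulrC.
by rewrite ler_wpM2l // (le_trans (ler_norm _)) // lerDl.
Qed.

Lemma mulmx_continuous m d (M : 'M[R]_(m, d)) :
  continuous (fun p : 'rV[R]_m => p *m M).
Proof.
have [C _ CM] := mulmx_lipschitz M.
by apply: (@lipschitz_continuous _ _ _ C) => u v; rewrite -mulmxBl.
Qed.

(** Near [x], the closed sets that miss [x] can be avoided, and finitely many pieces remain, all
    with the value [f x] at [x]. *)
Lemma continuous_closed_cover (T : topologicalType) (I : finType)
    (C : I -> set T) (h : I -> T -> R) (f : T -> R) :
    (forall i, closed (C i)) -> (forall i, continuous (h i)) ->
    (forall x, exists i, C i x) -> (forall i x, C i x -> f x = h i x) ->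
  continuous f.
Proof.
move=> Ccl hc Ccov fh x; apply/cvgrPdist_lt => e e0.
have : \forall y \near x, forall i, C i y -> `|f x - h i y| < e.
  apply: filter_forall => i.
  have [Cx|nCx] := pselect (C i x).
    move/cvgrPdist_lt : (hc i x) => /(_ e e0); apply: filterS => y.
    by rewrite (fh i).
  have /filterS : \forall y \near x, ~ C i y.
    by apply: open_nbhs_nbhs; split => //; apply: closed_openC.
  by apply => y nCy /nCy.
by apply: filterS => y H; have [i Ci] := Ccov y; rewrite (fh i y Ci); apply: H.
Qed.

(** Only [x] is confined to [K]: a perturbed point is later compared with a point of a compact image
    that it may leave. *)
Lemma uniform_on_compact (U V : normedModType R) (f : U -> V) (K : set U)
    (e : R) : compact K -> continuous f -> 0 < e ->
  exists2 d : R, 0 < d & forall x y, K x -> `|x - y| <= d -> `|f x - f y| <= e.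
Proof.
move=> Kc fc e0.
have /compact_near_coveringP := Kc.
move=> /(_ R (0^'+)%R (fun d x => forall y, `|x - y| <= d -> `|f x - f y| <= e)).
move=> H.
have {}H : \forall d \near 0^'+,
    K `<=` (fun x => forall y, `|x - y| <= d -> `|f x - f y| <= e).
  apply: H => x Kx.
  have /cvgrPdist_lt/(_ (e / 2)) := fc x.
  rewrite divr_gt0 // => /(_ isT) /nbhs_normP [/= r r0 rP].
  exists (ball x (r / 2), [set d | d < r / 2]).
    split => /=; first by apply: nbhsx_ballx; rewrite divr_gt0.
    by apply: nbhs_right_lt; rewrite divr_gt0.
  move=> [z d] /= [xz dr] y zy.
  rewrite -ball_normE /ball_ /= in xz.
  have r2 : r / 2 < r by rewrite ltr_pdivrMr // ltr_pMr // ltr1n.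
  have fz : `|f x - f z| < e / 2 by apply: rP => /=; exact: lt_trans r2.
  have fy : `|f x - f y| < e / 2.
    apply: rP => /=; apply: le_lt_trans (ler_distD z x y) _.
    by rewrite [r]splitr ltrD // (le_lt_trans zy).
  apply: le_trans (ler_distD (f x) _ _) _.
  by rewrite distrC [e]splitr lerD // ltW.
near (0:R)^'+ => d.
exists d; first by near: d; exact: nbhs_right_gt.
move=> x y Kx; move: x Kx y; near: d; exact: H.
Unshelve. all: by end_near. Qed.

Lemma unit_cube_compact e : compact (@unit_cube R e).
Proof.
have H : compact [set v : 'rV[R]_e | forall i, v ord0 i \in `[0, 1]].
  apply: (@rV_compact R e (fun=> `[0, 1]%classic : set R)) => _.
  exact: segment_compact.
suff -> : @unit_cube R e = [set v : 'rV[R]_e | forall i, v ord0 i \in `[0, 1]].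
  by [].
by apply/seteqP; split => v /= vH j; have := vH j; rewrite in_itv.
Qed.

Lemma bounded_on_cube e (V : normedModType R) (f : 'rV[R]_e -> V) :
  continuous f -> exists2 M : R, 0 <= M & forall u, unit_cube u -> `|f u| <= M.
Proof.
move=> fc; have /compact_bounded : compact (f @` @unit_cube R e).
  apply: continuous_compact (@unit_cube_compact e).
  exact: continuous_subspaceT.
move=> [M [_ H]]; exists (`|M| + 1); first by rewrite addr_ge0.
move=> u cu; apply: H; last by exists u.
by rewrite (le_lt_trans (ler_norm _)) // ltrDl.
Qed.

End RowVectors.

(** * General position *)

Section Perturbation.
Context {R : realType}.

(* The infimal convolution of [f] with [L * `|.|], for [L] large. *)
Lemma lipschitz_approx_fun e (f : 'rV[R]_e -> R) (eps : R) :
  continuous f -> 0 < eps ->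
  exists L g, [/\ 0 <= L, forall u v, `|g u - g v| <= L * `|u - v| &
    forall u, unit_cube u -> `|g u - f u| <= eps].
Proof.
move=> fc eps0; have [M M0 fM] := bounded_on_cube fc.
have [d d0 fd] := uniform_on_compact (@unit_cube_compact R e) fc eps0.
(* With this [L], a point farther than [d] from [u] has penalty at least [2 M] and cannot bring the
   infimum below [f u]; a nearer one does so by at most [eps]. *)
have [L [L0 LM]] : exists L, 0 <= L /\ M + M = L * d.
  by exists ((M + M) / d); rewrite divr_ge0 ?addr_ge0 ?(ltW d0) // divfK ?gt_eqF.
pose A u := [set f y + L * `|u - y| | y in @unit_cube R e].
pose g u := inf (A u).
have cube0 : @unit_cube R e 0 by move=> j; rewrite mxE lexx ler01.
have An0 u : A u !=set0 by exists (f 0 + L * `|u - 0|), 0.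
have Albd u : has_lbound (A u).
  exists (- M) => _ [y cy <-]; rewrite -[leLHS]addr0 lerD ?mulr_ge0 //.
  by have := fM y cy; rewrite ler_norml => /andP[].
have gle u y : unit_cube y -> g u <= f y + L * `|u - y|.
  by move=> cy; apply: (ge_inf (Albd u)); exists y.
have gL u v : g u - g v <= L * `|u - v|.
  rewrite lerBlDl -lerBlDr; apply: lb_le_inf => // _ [y cy <-].
  rewrite lerBlDr; apply: le_trans (gle u y cy) _.
  by rewrite -addrA lerD2l -mulrDr ler_wpM2l // [leRHS]addrC ler_distD.
exists L, g; split=> // [u v|u cu].
  by rewrite ler_norml gL andbT lerNl opprB distrC gL.
rewrite distrC ger0_norm; last first.
  by rewrite subr_ge0; have := gle u u cu; rewrite subrr normr0 mulr0 addr0.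
rewrite lerBlDr -lerBlDl; apply: lb_le_inf => // _ [y cy <-].
have [ud|ud] := leP `|u - y| d.
  have := fd u y cu ud; rewrite ler_norml => /andP[_].
  by have := mulr_ge0 L0 (normr_ge0 (u - y)); lra.
have Ld : M + M <= L * `|u - y|.
  by rewrite LM ler_wpM2l // ltW.
have := fM y cy; have := fM u cu; rewrite !ler_norml => /andP[_ ?] /andP[? _].
lra.
Qed.

Lemma lipschitz_approx e d (F : 'rV[R]_e -> 'rV[R]_d) (eps : R) :
  continuous F -> 0 < eps ->
  exists L G, [/\ 0 <= L, forall u v, `|G u - G v| <= L * `|u - v| &
    forall u, unit_cube u -> `|G u - F u| <= eps].
Proof.
move=> Fc eps0.
have H j : exists Lg : R * ('rV[R]_e -> R), [/\ 0 <= Lg.1,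
    forall u v, `|Lg.2 u - Lg.2 v| <= Lg.1 * `|u - v| &
    forall u, unit_cube u -> `|Lg.2 u - F u ord0 j| <= eps].
  have : continuous (fun u => F u ord0 j).
    move=> u; apply: (@continuous_comp _ _ _ F (fun x : 'rV[R]_d => x ord0 j)).
      exact: Fc.
    exact: coord_continuous.
  by move=> /lipschitz_approx_fun/(_ eps0)[L [g ?]]; exists (L, g).
have [Lg LgP] := choice H.
have S0 : 0 <= \sum_j (Lg j).1 by apply: sumr_ge0 => j _; case: (LgP j).
exists (\sum_j (Lg j).1), (fun u => \row_j (Lg j).2 u); split=> // [u v|u cu].
  apply: row_norm_le => [|j]; first by rewrite mulr_ge0.
  rewrite !mxE; case: (LgP j) => _ /(_ u v) LgL _; apply: le_trans LgL _.
  rewrite ler_wpM2r // (bigD1 j) //= lerDl; apply: sumr_ge0 => i _.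
  by case: (LgP i).
apply: row_norm_le => [|j]; first exact: ltW.
by rewrite !mxE; case: (LgP j) => _ _; apply.
Qed.

Lemma truncn_cell (k : nat) (s t : R) : 0 <= s -> 0 <= t ->
  Num.truncn (k.+1%:R * s) = Num.truncn (k.+1%:R * t) ->
  `|s - t| <= k.+1%:R^-1.
Proof.
move=> s0 t0 st.
have /truncn_itv : 0 <= k.+1%:R * s by rewrite mulr_ge0.
have /truncn_itv : 0 <= k.+1%:R * t by rewrite mulr_ge0.
rewrite -st; set c := Num.truncn _ => /andP[a1 a2] /andP[b1 b2].
have k0 : 0 < k.+1%:R :> R by rewrite ltr0n.
have H : `|k.+1%:R * s - k.+1%:R * t| <= 1.
  rewrite -[X in _ < X]natr1 in a2; rewrite -[X in _ < X]natr1 in b2.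
  by rewrite ler_norml; apply/andP; split; lra.
rewrite -[k.+1%:R^-1]mulr1 ler_pdivlMl // -[X in X * _](gtr0_norm k0) -normrM.
by rewrite mulrBr.
Qed.

(* Pigeonhole: a cube in 'rV_d contains (K+1)^d points at pairwise distance
   eps / K, whereas the images are covered by O(K^e) sets of smaller diameter. *)
Lemma lipschitz_images_miss_point e d (J : finType)
    (E : J -> 'rV[R]_e -> 'rV[R]_d) (C eps : R) :
  (e < d)%N -> 0 < eps ->
  (forall j u v, unit_cube u -> unit_cube v ->
     `|E j u - E j v| <= C * `|u - v|) ->
  exists2 v : 'rV[R]_d, `|v| <= eps & forall j u, unit_cube u -> E j u <> v.
Proof.
move=> ed eps0 EL.
have [c cC] : exists c : nat, C < eps * c.+1%:R.
  exists (Num.truncn (`|C| / eps)).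
  rewrite mulrC -ltr_pdivrMr //; apply: le_lt_trans (truncnS_gt _).
  by rewrite ler_pM2r ?invr_gt0 // ler_norm.
(* Chosen so that the number [#|J| * k.+2 ^ e] of cells below is at most [K * K.+2 ^ e], which is
   less than the number [K.+2 ^ d] of points. *)
pose K := (#|J| * (c.+1 * 2) ^ e)%N.
pose pt (g : {ffun 'I_d -> 'I_K.+2}) : 'rV[R]_d :=
  \row_j (eps * ((g j : nat)%:R / K.+1%:R)).
have K0 : 0 < K.+1%:R :> R by rewrite ltr0n.
have ptle g : `|pt g| <= eps.
  apply: row_norm_le => [|j]; first exact: ltW.
  rewrite mxE normrM gtr0_norm // ler_piMr ?(ltW eps0) // ger0_norm ?divr_ge0 //.
  by rewrite ler_pdivrMr // mul1r ler_nat -ltnS.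
have ptsep g g' : g != g' -> eps / K.+1%:R <= `|pt g - pt g'|.
  move=> gg'; have [j gj] : exists j, g j != g' j.
    apply/existsP; apply: contraNT gg' => /existsPn gj.
    by apply/eqP/ffunP => j; apply/eqP; rewrite -[_ == _]negbK gj.
  apply: le_trans (coord_le_norm _ j).
  rewrite !mxE -mulrBr -mulrBl normrM (gtr0_norm eps0) ler_pM2l // normrM.
  rewrite [ `|K.+1%:R^-1|]ger0_norm ?invr_ge0 // ler_peMl ?invr_ge0 //.
  wlog lt : g g' {gg'} gj / (g j < g' j)%N.
    move=> W; have := gj; rewrite neq_ltn => /orP[|] /W; first exact.
    by rewrite distrC; apply; rewrite eq_sym.
  rewrite distrC -natrB ?(ltnW lt) // ger0_norm //.
  by rewrite (ler_nat _ 1) subn_gt0.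
apply: contrapT => noP.
have hit g : exists x : J * 'rV[R]_e, unit_cube x.2 /\ E x.1 x.2 = pt g.
  apply: contrapT => H; apply: noP; exists (pt g) => // j u cu Eu.
  by apply: H; exists (j, u).
have [h hP] := choice hit.
pose k := (c.+1 * K.+1)%N.-1.
have kE : k.+1 = (c.+1 * K.+1)%N by [].
(* There are [k.+2] values per coordinate because the coordinate 1 gives [k.+1]. *)
pose cell g : J * {ffun 'I_e -> 'I_k.+2} :=
  ((h g).1, [ffun i => inord (Num.truncn (k.+1%:R * (h g).2 ord0 i))]).
have cell_inj : injective cell.
  move=> g g' [hj /ffunP hc]; apply/eqP; apply: contraT => /ptsep.
  have [cu <-] := hP g; have [cu' <-] := hP g'.
  rewrite -hj => le1.
  have small : `|(h g).2 - (h g').2| <= k.+1%:R^-1.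
    apply: row_norm_le => [|i]; first by rewrite invr_ge0.
    rewrite !mxE; have /andP[s0 s1] := cu i; have /andP[t0 t1] := cu' i.
    apply: truncn_cell => //.
    have bnd (s : R) : 0 <= s -> s <= 1 -> (Num.truncn (k.+1%:R * s) < k.+2)%N.
      move=> z0 z1; rewrite ltnS -(ler_nat R).
      have /truncn_itv/andP[le _] : 0 <= k.+1%:R * s by rewrite mulr_ge0.
      by apply: le_trans le _; rewrite ler_piMr.
    have := hc i; rewrite !ffunE => /(congr1 val) /=.
    by rewrite !inordK ?bnd.
  have le2 := EL (h g).1 _ _ cu cu'.
  have : eps / K.+1%:R < eps / K.+1%:R; last by rewrite ltxx.
  apply: le_lt_trans le1 _; apply: le_lt_trans le2 _.
  have [C0|C0] := ltP C 0.
    by apply: (@le_lt_trans _ _ 0); rewrite ?divr_gt0 // mulr_le0_ge0 // ltW.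
  apply: le_lt_trans (ler_wpM2l C0 small) _.
  rewrite kE natrM invfM mulrA ltr_pM2r ?invr_gt0 //.
  by rewrite ltr_pdivrMr ?ltr0n.
have := leq_card cell cell_inj.
rewrite card_prod !card_ffun !card_ord => le1.
have le2 : (k.+2 ^ e <= (c.+1 * 2) ^ e * K.+2 ^ e)%N.
  rewrite -expnMn; have [->|e0] := posnP e; first by rewrite !expn0.
  by rewrite leq_exp2r // kE; lia.
have : (K.+2 ^ d <= K * K.+2 ^ e)%N.
  apply: leq_trans le1 _; rewrite /K -mulnA leq_mul2l; apply/orP; right.
  exact: le2.
rewrite -(subnK (ltnW ed)) expnD leq_pmul2r ?expn_gt0 //.
rewrite -(@prednK (d - e)) ?subn_gt0 // expnS leqNgt.
suff -> : (K < K.+2 * K.+2 ^ (d - e).-1)%N by [].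
by apply: (@leq_trans (K.+2 * 1)); [lia | rewrite leq_mul2l expn_gt0].
Qed.

(** A translate [G + w] of a Lipschitz approximation meets the row space of [M j] only if [w] is
    [p *m M j - G u] for some [p] and [u]. Once [p] is bounded, such [w] fill finitely many
    Lipschitz images of a cube of dimension [e + k < d], which leave out arbitrarily small
    vectors. *)
Lemma general_position e k d (F : 'rV[R]_e -> 'rV[R]_d) (J : finType)
    (M : J -> 'M[R]_(k, d)) (eps : R) :
  (e + k < d)%N -> continuous F -> 0 < eps ->
  exists G : 'rV[R]_e -> 'rV[R]_d, [/\ continuous G,
    forall u, unit_cube u -> `|G u - F u| <= eps &
    forall j p u, unit_cube u -> G u <> p *m M j].
Proof.
move=> ekd Fc eps0.
have eps2 : 0 < eps / 2 by rewrite divr_gt0.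
have [L [G [L0 GL GF]]] := lipschitz_approx Fc eps2.
have Gc : continuous G by exact: lipschitz_continuous GL.
have [B B0 GB] := bounded_on_cube Gc.
have /choice[a aP] : forall j, exists C : R, 0 <= C /\
    forall x : 'rV[R]_d, `|x *m pinvmx (M j)| <= C * `|x|.
  by move=> j; have [C C0 CP] := mulmx_lipschitz (pinvmx (M j)); exists C.
have /choice[b bP] : forall j, exists C : R, 0 <= C /\
    forall x : 'rV[R]_k, `|x *m M j| <= C * `|x|.
  by move=> j; have [C C0 CP] := mulmx_lipschitz (M j); exists C.
have a0 j : 0 <= a j * (B + eps).
  by rewrite mulr_ge0 ?addr_ge0 ?(ltW eps0) //; case: (aP j).
have [r [r0 rP]] : exists r, 0 < r /\ forall j, a j * (B + eps) <= r.
  exists (\sum_j a j * (B + eps) + 1); split=> [|j].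
    by apply: ltr_wpDl => //; apply: sumr_ge0.
  by rewrite (bigD1 j) //= -addrA lerDl addr_ge0 // sumr_ge0.
(* The last [k] coordinates are rescaled from [0, 1] to [-r, r], the range of the relevant [p]. *)
pose E j (q : 'rV[R]_(e + k)) : 'rV[R]_d :=
  (r *: (2 *: rsubmx q - const_mx 1)) *m M j - G (lsubmx q).
have lsub_le (q : 'rV[R]_(e + k)) : `|lsubmx q| <= `|q|.
  by apply: row_norm_le => // i; rewrite mxE coord_le_norm.
have rsub_le (q : 'rV[R]_(e + k)) : `|rsubmx q| <= `|q|.
  by apply: row_norm_le => // i; rewrite mxE coord_le_norm.
have b0 j : 0 <= b j by case: (bP j).
have EL j u v : unit_cube u -> unit_cube v ->
    `|E j u - E j v| <= (\sum_i b i * (r * 2) + L) * `|u - v|.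
  move=> _ _; rewrite /E.
  rewrite [X in `|X|](_ : _ =
      ((r * 2) *: (rsubmx (u - v))) *m M j - (G (lsubmx u) - G (lsubmx v))).
    rewrite mulrDl; apply: le_trans (ler_normB _ _) _; apply: lerD.
      have [_ H] := bP j; apply: le_trans (H _) _.
      rewrite normrZ gtr0_norm ?mulr_gt0 // mulrA ler_pM ?mulr_ge0 ?(ltW r0) //.
      rewrite (bigD1 j) //= lerDl; apply: sumr_ge0 => i _.
      by rewrite !mulr_ge0 ?(ltW r0).
    by apply: le_trans (GL _ _) _; rewrite ler_wpM2l // -linearB lsub_le.
  have -> : (r * 2) *: rsubmx (u - v) = r *: (2 *: rsubmx u - const_mx 1)
      - r *: (2 *: rsubmx v - const_mx 1).
    by rewrite -scalerBr -scalerA linearB opprB addrA subrK scalerBr.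
  by rewrite mulmxBl opprD opprK addrACA opprB [_ + G _]addrC.
have [w wle wE] := lipschitz_images_miss_point ekd eps2 EL.
exists (fun u => G u + w); split.
- apply: (@lipschitz_continuous _ _ _ _ L) => u v.
  by rewrite opprD addrACA subrr addr0.
- move=> u cu; rewrite addrAC [eps]splitr.
  by apply: le_trans (ler_normD _ _) _; rewrite lerD ?GF.
move=> j p u cu Gp.
pose x := G u + w.
have xle : `|x| <= B + eps.
  apply: le_trans (ler_normD _ _) _; rewrite lerD ?GB //.
  by apply: le_trans wle _; rewrite ler_pdivrMr // ler_peMr ?(ltW eps0) // ler1n.
have xM : (x <= M j)%MS by rewrite /x Gp submxMl.
(* The rows of [M j] may be dependent, so [p] is not bounded in terms of its image; the
   pseudo-inverse supplies a preimage that is. *)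
have [p' p'M p'le] : exists2 p', p' *m M j = x & forall i, `|p' ord0 i| <= r.
  exists (x *m pinvmx (M j)) => [|i]; first by rewrite mulmxKpV.
  apply: le_trans (coord_le_norm _ _) _.
  have [aj0 H] := aP j; apply: le_trans (H x) _.
  exact: le_trans (ler_wpM2l aj0 xle) (rP j).
pose q : 'rV[R]_(e + k) := row_mx u (2^-1 *: (r^-1 *: p' + const_mx 1)).
apply: (wE j q).
  move=> i; rewrite /q; have [i' ->|i' ->] := split_ordP i.
    by rewrite row_mxEl.
  rewrite row_mxEr !mxE.
  have : `|r^-1 * p' ord0 i'| <= 1.
    by rewrite normrM gtr0_norm ?invr_gt0 // ler_pdivrMl // mulr1.
  by rewrite ler_norml => /andP[? ?]; apply/andP; split; lra.
rewrite /E /q row_mxKl row_mxKr scalerA mulfV ?pnatr_eq0 // scale1r addrK.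
by rewrite scalerA mulfV ?gt_eqF // scale1r p'M /x [X in X - _]addrC addrK.
Qed.

End Perturbation.

(** * Cells and the barycentric subdivision *)

Section ImageRows.
Context {R : realType} (N : nat).
Implicit Types (s : {fset 'rV[R]_N}) (w : 'rV[R]_N -> R).

(** Turns combinations over a finite set into matrix products, so that ranks and row spaces apply to
    them. *)
Definition image_rows M (g : 'rV[R]_N -> 'rV[R]_M) s : 'M[R]_(#|` s|, M) :=
  \matrix_i g (nth 0 s i).

Definition weight_row s w : 'rV[R]_#|` s| := \row_i w (nth 0 s i).

Lemma mul_image_rows M (g : 'rV[R]_N -> 'rV[R]_M) s w :
  weight_row s w *m image_rows g s = \sum_(v <- s) w v *: g v.
Proof.
rewrite mulmx_sum_row (big_nth 0) big_mkord; apply: eq_bigr => i _.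
by rewrite rowK mxE.
Qed.

Lemma weight_rowP s (x : 'rV[R]_#|` s|) : exists w, x = weight_row s w.
Proof.
exists (fun v => \sum_(i < #|` s| | nth 0 s i == v) x ord0 i).
apply/rowP => i; rewrite mxE (bigD1 i) //= big1 ?addr0 // => j /andP[/eqP ij].
case/eqP; apply: val_inj; apply/eqP.
by rewrite -(nth_uniq 0 _ _ (fset_uniq s)) ?ltn_ord // ij.
Qed.

End ImageRows.

Definition weight_at (R : realType) d (w : 'rV[R]_d -> R) t a : 'rV[R]_d -> R :=
  fun v => if v == t then a else w v.

Section Cells.
Context {R : realType} (m : nat) (I : finType) (l : I -> 'cV[R]_m.+2).
Local Notation vec := 'rV[R]_m.+2.

Definition eval_at i (x : vec) : R := (x *m l i) ord0 ord0.

(** As the functionals will come in opposite pairs, the positive ones determine all signs, and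
    inclusion of these sets is the face relation. *)
Definition cell (x : vec) : {set I} := [set i | 0 < eval_at i x]%SET.

(** The cone with apex 0 over the sphere. In it, multiples of vertices can be removed one at a time
    without renormalizing. *)
Definition orthant_boundary : set vec :=
  [set z | (forall j, 0 <= z ord0 j) /\ exists j, z ord0 j = 0].

Hypothesis l_neg : forall i, exists i', forall x, eval_at i' x = - eval_at i x.
Hypothesis l_coord : forall k, exists i, forall x, eval_at i x = x ord0 k.

Lemma eval_at0 i : eval_at i 0 = 0.
Proof. by rewrite /eval_at mul0mx mxE. Qed.

Lemma eval_atB i x y : eval_at i (x - y) = eval_at i x - eval_at i y.
Proof. by rewrite /eval_at mulmxBl !mxE. Qed.

Lemma eval_atD i x y : eval_at i (x + y) = eval_at i x + eval_at i y.
Proof. by rewrite /eval_at mulmxDl !mxE. Qed.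

Lemma eval_atZ i a x : eval_at i (a *: x) = a * eval_at i x.
Proof. by rewrite /eval_at -scalemxAl !mxE. Qed.

Lemma eval_at_sum i (r : seq vec) (w : vec -> R) :
  eval_at i (\sum_(v <- r) w v *: v) = \sum_(v <- r) w v * eval_at i v.
Proof.
elim: r => [|v r IH]; first by rewrite !big_nil eval_at0.
by rewrite !big_cons eval_atD eval_atZ IH.
Qed.

Lemma cell_le0 i x y : cell x \subset cell y -> eval_at i y <= 0 ->
  eval_at i x <= 0.
Proof.
move=> /fintype.subsetP/(_ i); rewrite !inE !leNgt => xy.
by apply: contra => /xy.
Qed.

Lemma cell_ge0 i x y : cell x \subset cell y -> 0 <= eval_at i y ->
  0 <= eval_at i x.
Proof.
have [i' iP] := l_neg i; move=> xy.
by rewrite -oppr_le0 -(oppr_le0 (eval_at i x)) -!iP; exact: cell_le0.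
Qed.

Lemma cell_eq0 i x y : cell x \subset cell y -> eval_at i y = 0 ->
  eval_at i x = 0.
Proof.
move=> xy yi; apply/eqP.
by rewrite eq_le (cell_le0 xy) ?(cell_ge0 xy) // yi.
Qed.

Lemma cell_orthant_boundary x y : cell x \subset cell y ->
  orthant_boundary y -> orthant_boundary x.
Proof.
move=> xy [y0 [k yk]]; split=> [j|].
  by have [i iP] := l_coord j; rewrite -iP (cell_ge0 xy) // iP.
exists k; have [i iP] := l_coord k; rewrite -iP.
by apply: cell_eq0 xy _; rewrite iP.
Qed.

(** A functional positive at [t] is nonnegative on every term and positive on that of [t]; one
    nonpositive at [t] is nonpositive on every term. *)
Lemma cell_sum (r : seq vec) (w : vec -> R) t : t \in r -> 0 < w t ->
  (forall v, v \in r -> 0 <= w v) ->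
  (forall v, v \in r -> w v != 0 -> cell v \subset cell t) ->
  cell (\sum_(v <- r) w v *: v) = cell t.
Proof.
move=> tr wt w0 sub; apply/finset.setP => i; rewrite !inE eval_at_sum.
have [it|it] := ltP 0 (eval_at i t).
  have ge0 v : v \in r -> 0 <= w v * eval_at i v.
    move=> vr; have [->|wv] := eqVneq (w v) 0; first by rewrite mul0r.
    by rewrite mulr_ge0 ?w0 // (cell_ge0 (sub v vr wv)) // ltW.
  rewrite (big_rem t) //= ltr_pwDl ?mulr_gt0 // big_seq.
  by apply: sumr_ge0 => v /mem_rem; apply: ge0.
apply: negbTE; rewrite -leNgt big_seq; apply: sumr_le0 => v vr.
have [->|wv] := eqVneq (w v) 0; first by rewrite mul0r.
by rewrite mulr_ge0_le0 ?w0 // (cell_le0 (sub v vr wv)).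
Qed.

Lemma cell_sphere_neq0 x : pl_sphere R m x -> cell x != finset.set0.
Proof.
case=> x0 x1 _; apply: contra_eqN x1 => /eqP c0.
rewrite big1 ?oner_eq0 1?eq_sym ?oner_neq0 // => j _; apply/eqP.
rewrite eq_le x0 andbT leNgt; have [i iP] := l_coord j; rewrite -iP.
by apply/negP => xi; have := finset.in_set0 i; rewrite -c0 inE xi.
Qed.

Lemma cell0 : cell 0 = finset.set0.
Proof. by apply/finset.setP => i; rewrite !inE eval_at0 ltxx. Qed.

Lemma cellZ a x : 0 < a -> cell (a *: x) = cell x.
Proof. by move=> a0; apply/finset.setP => i; rewrite !inE eval_atZ pmulr_rgt0. Qed.

Lemma sphere_orthant_boundary x : pl_sphere R m x -> orthant_boundary x.
Proof. by case. Qed.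

Definition chain (s : {fset vec}) :=
  {in s &, forall u v, (cell u \subset cell v) || (cell v \subset cell u)}.

Lemma chain_max (r : seq vec) : r != [::] ->
  {in r &, forall u v, (cell u \subset cell v) || (cell v \subset cell u)} ->
  exists2 t, t \in r & forall u, u \in r -> cell u \subset cell t.
Proof.
elim: r => // v r IH _ chr.
have [->|rn] := eqVneq r [::].
  by exists v; rewrite ?mem_head // => u; rewrite inE => /eqP ->.
have [|t tr tP] := IH rn.
  by move=> a b ar br; apply: chr; rewrite inE ?ar ?br orbT.
have /orP[vt|tv] := chr v t (mem_head _ _) (mem_behead (s := v :: r) tr).
  exists t; first by rewrite inE tr orbT.
  by move=> u; rewrite inE => /orP[/eqP ->|/tP].
exists v; first by rewrite mem_head.
move=> u; rewrite inE => /orP[/eqP -> //|/tP ut]; exact: fintype.subset_trans ut tv.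
Qed.

(* One vertex in the interior of each cell; chains of vertices span the
   simplices of the barycentric subdivision of the cell complex. *)
Definition cell_vertices (V : {fset vec}) : Prop :=
  [/\ forall v, v \in V -> pl_sphere R m v, {in V &, injective cell} &
      forall x, pl_sphere R m x -> exists2 v, v \in V & cell v = cell x].

Lemma cell_vertices_exist : exists V, cell_vertices V.
Proof.
pose pt (c : {set I}) := xget (0 : vec) [set x | pl_sphere R m x /\ cell x = c].
pose ok (c : {set I}) := `[< exists x, pl_sphere R m x /\ cell x = c >].
have ptP c : ok c -> pl_sphere R m (pt c) /\ cell (pt c) = c.
  by move=> /asboolP H; exact: (xgetPex _ H).
exists [fset v in [seq pt c | c <- enum {set I} & ok c]]%fset; split.
- by move=> v; rewrite inE => /mapP[c]; rewrite mem_filter => /andP[/ptP[? ?] _] ->.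
- move=> u v; rewrite !inE => /mapP[c + ->] /mapP[c' + ->].
  rewrite !mem_filter => /andP[/ptP[_ cE] _] /andP[/ptP[_ cE'] _].
  by rewrite cE cE' => ->.
- move=> x Sx; have /ptP[_ cE] : ok (cell x) by apply/asboolP; exists x.
  exists (pt (cell x)) => //; rewrite inE; apply/mapP; exists (cell x) => //.
  by rewrite mem_filter mem_enum andbT; apply/asboolP; exists x.
Qed.

(** * Coordinates in the cone over the subdivision *)

Section Weights.
Variable V : {fset vec}.
Hypothesis HV : cell_vertices V.

(** A conical version of barycentric coordinates: the weights need not add up to 1. They vanish off
    [V], so that uniqueness can be an equality of functions. *)
Definition represents (w : vec -> R) (z : vec) : Prop :=
  [/\ forall v, 0 <= w v, forall v, w v != 0 -> v \in V,
      forall u v, w u != 0 -> w v != 0 ->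
        (cell u \subset cell v) || (cell v \subset cell u) &
      z = \sum_(v <- V) w v *: v].

Lemma vertex_inj u v : u \in V -> v \in V -> cell u = cell v -> u = v.
Proof. by case: HV => _ H _; exact: H. Qed.

Lemma vertex_sphere v : v \in V -> pl_sphere R m v.
Proof. by case: HV => H _ _; exact: H. Qed.

Lemma vertex_cell_neq0 v : v \in V -> cell v != finset.set0.
Proof. by move/vertex_sphere/cell_sphere_neq0. Qed.

(** The largest vertex of the chain has all the signs of the sum. So the point alone determines the
    top vertex of any of its representations. *)
Lemma represents_top w z u : represents w z -> w u != 0 ->
  exists t, [/\ t \in V, w t != 0, cell t = cell z &
    forall v, w v != 0 -> cell v \subset cell z].
Proof.
move=> [w0 wV wch ->] wu.
have [||t] := @chain_max [seq v <- V | w v != 0].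
- rewrite -size_eq0 -lt0n size_filter -has_count; apply/hasP.
  by exists u => //; exact: wV.
- by move=> a b; rewrite !mem_filter => /andP[? _] /andP[? _]; exact: wch.
rewrite mem_filter => /andP[wt tV] tP.
have sub v : w v != 0 -> cell v \subset cell t.
  by move=> wv; apply: tP; rewrite mem_filter wv wV.
have cE : cell (\sum_(v <- V) w v *: v) = cell t.
  apply: cell_sum => // [|v _]; first by rewrite lt0r wt w0.
  exact: sub.
by exists t; rewrite cE; split.
Qed.

Lemma represents_cell w z u : represents w z -> w u != 0 ->
  cell u \subset cell z.
Proof. by move=> wz wu; have [t [_ _ _]] := represents_top wz wu; apply. Qed.

Lemma represents_neq0 w z : represents w z -> cell z != finset.set0 ->
  exists u, w u != 0.
Proof.
move=> [_ _ _ ->]; apply: contraPP => /forallNP H; apply/negP; rewrite negbK.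
rewrite big1 ?cell0 // => v _.
by have /negP := H v; rewrite negbK => /eqP ->; rewrite scale0r.
Qed.

Lemma sum_weight_at (w : vec -> R) t a : t \in V ->
  \sum_(v <- V) weight_at w t a v *: v =
  \sum_(v <- V) w v *: v + (a - w t) *: t.
Proof.
move=> tV; rewrite (big_fsetD1 t) //= [in RHS](big_fsetD1 t) //=.
rewrite /weight_at eqxx [in RHS]addrAC -scalerDl subrKC; congr (_ + _).
rewrite [LHS]big_seq [RHS]big_seq; apply: eq_bigr => v.
by rewrite in_fsetD1 => /andP[/negbTE -> _].
Qed.

Lemma represents_weight_at w z t a : t \in V -> 0 <= a ->
  represents w z -> (forall v, w v != 0 ->
    (cell v \subset cell t) || (cell t \subset cell v)) ->
  represents (weight_at w t a) (z + (a - w t) *: t).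
Proof.
move=> tV a0 [w0 wV wch ->] cht; split.
- by move=> v; rewrite /weight_at; case: (v =P t).
- by move=> v; rewrite /weight_at; case: (v =P t) => [->|_] //; exact: wV.
- move=> u v; rewrite /weight_at.
  case: (u =P t) => [->|_]; case: (v =P t) => [->|_].
  + by rewrite subxx.
  + by move=> _ /cht; rewrite orbC.
  + by move=> /cht.
  + exact: wch.
- by rewrite sum_weight_at.
Qed.

Lemma represents_remove w z t : represents w z -> t \in V -> cell t = cell z ->
  represents (weight_at w t 0) (z - w t *: t).
Proof.
move=> wz tV tz; rewrite -[_ *: t]opprK -scaleNr -[- w t]sub0r opprK.
apply: represents_weight_at => // v wv.
by rewrite tz (represents_cell wz wv).
Qed.

(** If [w t < w' t], then [z - w t *: t] still contains [t] with positive weight according to [w'],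
    so its cell is that of [t]. According to [w], however, [t] has left the support, which then has
    no vertex for this cell. *)
Lemma represents_top_le w w' z t : represents w z -> represents w' z ->
  t \in V -> cell t = cell z -> w' t <= w t.
Proof.
move=> wz w'z tV tz; rewrite leNgt; apply/negP => lt.
have wrep := represents_remove wz tV tz.
have cE : cell (z - w t *: t) = cell t.
  have [w'0 _ _ zE] := w'z.
  rewrite zE -scaleNr -[- w t](addrK (w' t)) [- _ + _]addrC -sum_weight_at //.
  apply: cell_sum => //.
  - by rewrite /weight_at eqxx subr_gt0.
  - by move=> v _; rewrite /weight_at; case: (v =P t) => // _; rewrite subr_ge0 ltW.
  - move=> v _; rewrite /weight_at; case: (v =P t) => [->|_] // w'v.
    by rewrite tz (represents_cell w'z w'v).
have [u wu] : exists u, weight_at w t 0 u != 0.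
  by apply: represents_neq0 wrep _; rewrite cE vertex_cell_neq0.
have [s [sV ws sE _]] := represents_top wrep wu.
have st : s = t by apply: vertex_inj => //; rewrite sE cE.
by move: ws; rewrite st /weight_at eqxx eqxx.
Qed.

(** Induction on the size of the support: both representations have the same weight at the top
    vertex, and removing it leaves two representations of one point. *)
Lemma represents_uniq w w' z : represents w z -> represents w' z -> w = w'.
Proof.
have [k le_k] := ubnP (count (fun v => w v != 0) V).
elim: k w w' z le_k => // k IH w w' z; rewrite ltnS => le_k wz w'z.
have [c0|cn] := eqVneq (cell z) finset.set0.
  have vanish w1 : represents w1 z -> forall v, w1 v = 0.
    move=> w1z v; apply/eqP; apply: contraT => /(represents_top w1z).
    by case=> t [tV _ tz _]; have := vertex_cell_neq0 tV; rewrite tz c0 eqxx.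
  by apply/funext => v; rewrite !vanish.
have [u wu] := represents_neq0 wz cn.
have [t [tV wt tz _]] := represents_top wz wu.
have wtE : w t = w' t by apply/eqP; rewrite eq_le !(represents_top_le (z := z)).
have : weight_at w t 0 = weight_at w' t 0.
  apply: (IH _ _ (z - w t *: t)); last 2 first.
  - exact: represents_remove.
  - by rewrite wtE; exact: represents_remove.
  apply: leq_trans le_k; rewrite -!size_filter.
  rewrite [X in (_ < X)%N](perm_size (perm_to_rem (x := t) _)) ?mem_filter ?wt //=.
  rewrite ltnS uniq_leq_size ?filter_uniq ?fset_uniq // => v.
  rewrite mem_filter mem_rem_uniq ?filter_uniq ?fset_uniq // inE mem_filter /weight_at.
  by case: (v =P t) => [|_ ->] //; rewrite eqxx.
move=> /funeqP H; apply/funext => v; have := H v; rewrite /weight_at.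
by case: (v =P t) => [->|].
Qed.

Lemma orthant_boundary_vertex z : orthant_boundary z -> cell z != finset.set0 ->
  exists2 t, t \in V & cell t = cell z.
Proof.
move=> [z0 zk] cn.
have zn : z != 0 by apply: contraNneq cn => ->; rewrite cell0.
have [j zj] : exists j, z ord0 j != 0.
  apply/existsP; apply: contraNT zn => /existsPn H; apply/eqP/rowP => j.
  by rewrite mxE; have := H j; rewrite negbK => /eqP.
have s0 : 0 < \sum_j z ord0 j.
  rewrite (bigD1 j) //= ltr_pwDl ?sumr_ge0 // lt0r zj z0 //.
have Sz : pl_sphere R m ((\sum_j z ord0 j)^-1 *: z).
  split=> [i||].
  - by rewrite mxE mulr_ge0 // invr_ge0 ltW.
  - under eq_bigr do rewrite mxE.
    by rewrite -mulr_sumr mulVf // gt_eqF.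
  - by case: zk => k zk; exists k; rewrite mxE zk mulr0.
have [_ _ /(_ _ Sz)[t tV tE]] := HV.
by exists t; rewrite // tE cellZ // invr_gt0.
Qed.

(* Push [z] away from the vertex of its cell until it meets a smaller cell. *)
Lemma represents_exists z : orthant_boundary z -> exists w, represents w z.
Proof.
have [k le_k] := ubnP #|cell z|.
elim: k z le_k => // k IH z; rewrite ltnS => le_k zO.
have [c0|cn] := eqVneq (cell z) finset.set0.
  have -> : z = 0.
    apply/rowP => j; rewrite mxE; apply/eqP.
    case: zO => z0 _; rewrite eq_le z0 andbT leNgt.
    have [i iP] := l_coord j; rewrite -iP; apply/negP => zi.
    by have := finset.in_set0 i; rewrite -c0 inE zi.
  exists (fun=> 0); split=> //; try by move=> ?; rewrite eqxx.
  by rewrite big1 // => v _; rewrite scale0r.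
have [t tV tz] := orthant_boundary_vertex zO cn.
have /finset.set0Pn[i0 i0z] := cn.
have pos i : i \in cell z -> 0 < eval_at i z /\ 0 < eval_at i t.
  by move=> iz; split; [move: iz; rewrite inE | move: iz; rewrite -tz inE].
pose q i := eval_at i z / eval_at i t.
(* The first functional to vanish on the way from [z] in the direction of [- t]. *)
pose i1 := [arg min_(i < i0 in cell z) q i]%O.
have [i1z i1P] : i1 \in cell z /\ forall i, i \in cell z -> q i1 <= q i.
  by rewrite /i1; case: arg_minP.
have [zi1 ti1] := pos _ i1z.
have q0 : 0 < q i1 by rewrite divr_gt0.
pose y := z - q i1 *: t.
have yi1 : eval_at i1 y = 0.
  by rewrite eval_atB eval_atZ divfK ?subrr // gt_eqF.
have yle i : i \in cell z -> 0 <= eval_at i y.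
  move=> iz; have [_ ti] := pos i iz.
  by rewrite eval_atB eval_atZ subr_ge0 -ler_pdivlMr // i1P.
(* A functional not positive at [z] is either negative there, and then its opposite stays
   nonnegative at [y], or zero there, and then also at [t] and [y]. *)
have ysub : cell y \subset cell z.
  apply/fintype.subsetP => i; rewrite [i \in cell y]inE => yi.
  apply: contraT => iz.
  have [i' iP] := l_neg i.
  have [i'z|i'z] := boolP (i' \in cell z).
    by have := yle i' i'z; rewrite iP oppr_ge0 leNgt yi.
  have z0 : eval_at i z = 0.
    apply/eqP; rewrite eq_le; rewrite !inE -!leNgt iP oppr_le0 in iz i'z.
    by rewrite iz i'z.
  have t0 : eval_at i t = 0 by apply: (cell_eq0 (y := z)) z0; rewrite tz.
  by move: yi; rewrite eval_atB eval_atZ z0 t0 mulr0 subrr ltxx.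
have yprop : cell y \proper cell z.
  apply/fintype.properP; split=> //; exists i1 => //.
  by rewrite inE yi1 ltxx.
have [w wy] : exists w, represents w y.
  apply: IH; last exact: cell_orthant_boundary zO.
  exact: leq_trans (proper_card yprop) _.
exists (weight_at w t (q i1)).
have wt : w t = 0.
  apply/eqP; apply: contraT => /(represents_cell wy).
  by rewrite tz => zy; have := proper_subn yprop; rewrite zy.
have -> : z = y + (q i1 - w t) *: t by rewrite wt subr0 subrK.
apply: represents_weight_at => //; first exact: ltW.
by move=> v /(represents_cell wy) vy; rewrite tz (fintype.subset_trans vy ysub).
Qed.

Lemma chain_represents (s : {fset vec}) (w : vec -> R) :
  (s `<=` V)%fset -> chain s -> {in s, forall v, 0 <= w v} ->
  represents (fun v => if v \in s then w v else 0) (\sum_(v <- s) w v *: v).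
Proof.
move=> sV chs w0; split.
- by move=> v; case: ifP => // vs; exact: w0.
- by move=> v; case: ifP => [vs _|_]; rewrite ?eqxx //; exact: (fsubsetP sV).
- move=> u v; case: ifP => [us _|_]; rewrite ?eqxx //.
  by case: ifP => [vs _|_]; rewrite ?eqxx //; exact: chs.
- rewrite -(big_fset_incl _ sV) /=; last first.
    by move=> v _ /negbTE ->; rewrite scale0r.
  by rewrite [LHS]big_seq [RHS]big_seq; apply: eq_bigr => v ->.
Qed.

(** The positive and the negative part of a linear relation represent the same point, so they
    agree. *)
Lemma chain_free (s : {fset vec}) (a : vec -> R) :
  (s `<=` V)%fset -> chain s -> \sum_(v <- s) a v *: v = 0 ->
  {in s, forall v, a v = 0}.
Proof.
move=> sV chs a0 v vs.
pose p v := Num.max (a v) 0; pose q v := Num.max (- a v) 0.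
have pq u : a u = p u - q u.
  by rewrite /p /q; case: (leP (a u) 0); case: (leP (- a u) 0); lra.
have p0 : {in s, forall u, 0 <= p u} by move=> u _; rewrite le_max lexx orbT.
have q0 : {in s, forall u, 0 <= q u} by move=> u _; rewrite le_max lexx orbT.
have pqE : \sum_(v <- s) p v *: v = \sum_(v <- s) q v *: v.
  apply/eqP; rewrite -subr_eq0 -sumrB -[X in _ == X]a0; apply/eqP.
  by apply: eq_bigr => u _; rewrite -scalerBl -pq.
have prep := chain_represents sV chs p0.
rewrite pqE in prep.
have /funeqP/(_ v) := represents_uniq prep (chain_represents sV chs q0).
by rewrite vs pq => ->; rewrite subrr.
Qed.

Lemma chain_row_free s : (s `<=` V)%fset -> chain s -> row_free (image_rows id s).
Proof.
move=> sV chs; apply: inj_row_free => x; have [w ->] := weight_rowP x.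
rewrite mul_image_rows => w0; apply/rowP => i.
by rewrite !mxE (chain_free sV chs w0) // mem_nth.
Qed.

(** Bounds the length of a chain on which given functionals vanish: its members are independent
    vectors in the kernel of [N]. *)
Lemma chain_rank k s (N : 'M[R]_(m.+2, k)) : (s `<=` V)%fset -> chain s ->
  {in s, forall v, v *m N = 0} -> (#|` s| + \rank N <= m.+2)%N.
Proof.
move=> sV chs sN; have /eqP <- := chain_row_free sV chs.
apply: mulmx0_rank_max; apply/row_matrixP => i.
by rewrite row_mul rowK row0 sN // mem_nth.
Qed.

(** A column of a right inverse of the matrix of vertices. It reads off the weight at [v] linearly,
    as the continuity of the weights requires. *)
Lemma chain_dual s v : (s `<=` V)%fset -> chain s -> v \in s ->
  exists phi : 'cV[R]_m.+2,
    {in s, forall u, (u *m phi) ord0 ord0 = (u == v)%:R}.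
Proof.
move=> sV chs vs.
have [i iv] : exists i : 'I_#|` s|, nth 0 s i = v.
  have lt : (index v s < #|` s|)%N by rewrite index_mem.
  by exists (Ordinal lt); rewrite nth_index.
exists (col i (pinvmx (image_rows id s))) => u us.
have [j ju] : exists j : 'I_#|` s|, nth 0 s j = u.
  have lt : (index u s < #|` s|)%N by rewrite index_mem.
  by exists (Ordinal lt); rewrite nth_index.
have -> (B : 'M[R]_(m.+2, #|` s|)) :
    (u *m col i B) ord0 ord0 = (u *m B) ord0 i.
  by rewrite !mxE; apply: eq_bigr => k _; rewrite mxE.
have uE : u = row j (image_rows id s) by rewrite rowK.
rewrite {1}uE -row_mul mulmxVp ?chain_row_free // !mxE.
rewrite -ju -iv (nth_uniq _ _ _ (fset_uniq s)) ?ltn_ord //.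
Qed.

End Weights.
End Cells.

(** * Skeleta *)

Lemma fsubset_card (T : choiceType) (s : {fset T}) j : (j <= #|` s|)%N ->
  exists2 t, (t `<=` s)%fset & #|` t| = j.
Proof.
move=> js; exists [fset v in take j s]%fset.
  by apply/fsubsetP => v; rewrite inE => /mem_take.
by rewrite card_fseq undup_id ?take_uniq // size_take_min; apply/minn_idPl.
Qed.

Lemma conv_hull_sub (R : realType) d (s t : {fset 'rV[R]_d}) :
  (s `<=` t)%fset -> conv_hull s `<=` conv_hull t.
Proof.
move=> st _ [w [w0 w1] ->].
exists (fun v => if v \in s then w v else 0).
  split=> [v _|]; first by case: ifP => // /w0.
  rewrite -(big_fset_incl _ st) /= => [|v _ /negbTE -> //].
  by rewrite -w1 [LHS]big_seq [RHS]big_seq; apply: eq_bigr => v ->.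
rewrite -(big_fset_incl _ st) /= => [|v _ /negbTE ->]; last by rewrite scale0r.
by rewrite [LHS]big_seq [RHS]big_seq; apply: eq_bigr => v ->.
Qed.

Section Skeleton.
Context {R : realType} (m : nat) (I : finType) (l : I -> 'cV[R]_m.+2).
Local Notation vec := 'rV[R]_m.+2.
Hypothesis l_neg :
  forall i, exists i', forall x, eval_at l i' x = - eval_at l i x.
Hypothesis l_coord : forall k, exists i, forall x, eval_at l i x = x ord0 k.
Variable V : {fset vec}.
Hypothesis HV : cell_vertices l V.

Definition support (w : vec -> R) : {fset vec} := [fset v in V | w v != 0]%fset.

Lemma in_support w v : (v \in support w) = (v \in V) && (w v != 0).
Proof. by rewrite !inE. Qed.

Lemma support_sub w : (support w `<=` V)%fset.
Proof. exact: fset_sub. Qed.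

Lemma sum_support (U : nmodType) w (F : vec -> U) :
  (forall v, w v = 0 -> F v = 0) ->
  \sum_(v <- support w) F v = \sum_(v <- V) F v.
Proof.
move=> F0; apply: big_fset_incl; first exact: support_sub.
by move=> v vV; rewrite in_support vV negbK => /eqP /F0.
Qed.

Lemma support_chain w z : represents l V w z -> chain l (support w).
Proof.
move=> [_ _ wch _] u v; rewrite !in_support => /andP[_ wu] /andP[_ wv].
exact: wch.
Qed.

Lemma represents_mass w z : represents l V w z ->
  \sum_j z ord0 j = \sum_(v <- V) w v.
Proof.
move=> [_ _ _ ->]; under eq_bigr do rewrite summxE.
rewrite exchange_big /= [LHS]big_seq [RHS]big_seq; apply: eq_bigr => v vV.
under eq_bigr do rewrite mxE.
by rewrite -mulr_sumr; case: (vertex_sphere HV vV) => _ -> _; rewrite mulr1.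
Qed.

(** Here [k] bounds the number of vertices, so the dimension is at most [k - 1]. *)
Definition skeleton (k : nat) : {fset {fset vec}} :=
  [fset s in fpowerset V | [&& s != fset0, (#|` s| <= k)%N & `[<chain l s>]]]%fset.

Lemma skeletonP k s : reflect
  [/\ (s `<=` V)%fset, s != fset0, (#|` s| <= k)%N & chain l s]
  (s \in skeleton k).
Proof.
rewrite !inE fpowersetE; apply: (iffP and4P) => [] [? ? ? /asboolP ?] //.
Qed.

Lemma represents_conv k s x : s \in skeleton k -> conv_hull s x ->
  exists2 w, represents l V w x & (support w `<=` s)%fset.
Proof.
move=> /skeletonP[sV _ _ chs] [w [w0 _] ->].
exists (fun v => if v \in s then w v else 0).
  exact: chain_represents.
apply/fsubsetP => v; rewrite in_support; case: ifP => // _.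
by rewrite eqxx andbF.
Qed.

Lemma conv_support w x : represents l V w x -> pl_sphere R m x ->
  conv_hull (support w) x.
Proof.
move=> wx [_ x1 _]; have [w0 _ _ xE] := wx.
exists w; last first.
  by rewrite sum_support // => v ->; rewrite scale0r.
split=> [v _|]; first exact: w0.
by rewrite sum_support // -x1 (represents_mass wx).
Qed.

(** A combination of a chain has the signs of its top vertex, which is on the sphere, and coordinate
    sum 1. *)
Lemma skeleton_sphere k : Defs.space (skeleton k) `<=` pl_sphere R m.
Proof.
move=> x [s sk xs]; have [w wx _] := represents_conv sk xs.
have /skeletonP[sV _ _ _] := sk.
have x1 : \sum_j x ord0 j = 1.
  case: xs => a [_ a1] ->; under eq_bigr do rewrite summxE.
  rewrite exchange_big /= -a1 [LHS]big_seq [RHS]big_seq.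
  apply: eq_bigr => v vs; under eq_bigr do rewrite mxE.
  rewrite -mulr_sumr; have [_ -> _] := vertex_sphere HV (fsubsetP sV v vs).
  by rewrite mulr1.
have [u wu] : exists u, w u != 0.
  apply: contrapT => /forallNP w0; have := represents_mass wx.
  rewrite x1 big1 => [/eqP|v _]; first by rewrite oner_eq0.
  by apply/eqP; have /negP := w0 v; rewrite negbK.
have [t [tV _ tx _]] := represents_top l_neg wx wu.
have [x0 xk] : orthant_boundary x.
  apply: (cell_orthant_boundary l_neg l_coord (y := t)); first by rewrite tx.
  exact/sphere_orthant_boundary/(vertex_sphere HV).
by split.
Qed.

Lemma in_skeleton k w x : represents l V w x -> pl_sphere R m x ->
  (#|` support w| <= k)%N -> Defs.space (skeleton k) x.
Proof.
move=> wx Sx le_k; have xw := conv_support wx Sx.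
exists (support w) => //; apply/skeletonP; split=> //.
- exact: support_sub.
- apply/eqP => w0; move: xw; rewrite w0 => -[a [_]].
  by rewrite big_seq_fset0 => /eqP; rewrite eq_sym oner_eq0.
- exact: support_chain wx.
Qed.

Lemma skeleton_support k w x : represents l V w x -> Defs.space (skeleton k) x ->
  (#|` support w| <= k)%N.
Proof.
move=> wx [s sk xs]; have [w' w'x sub] := represents_conv sk xs.
rewrite (represents_uniq l_neg l_coord HV wx w'x).
by have /skeletonP[_ _ le_k _] := sk; apply: leq_trans le_k; apply: fsubset_leq_card.
Qed.

(** A point common to two simplices has only one system of weights, whose support therefore lies in
    both. *)
Lemma skeleton_complex k : simplicial_complex (skeleton k).
Proof.
split.
- move=> s /skeletonP[sV s0 _ chs]; split=> // w _ w0.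
  exact: (chain_free l_neg l_coord HV sV chs w0).
- move=> s t /skeletonP[sV s0 sk chs] ts t0; apply/skeletonP; split=> //.
  + exact: fsubset_trans ts sV.
  + exact: leq_trans (fsubset_leq_card ts) sk.
  + by move=> u v /(fsubsetP ts) us /(fsubsetP ts) vs; exact: chs.
- move=> s t sk tk; apply/seteqP; split=> x; last first.
    by move=> xst; split; apply: conv_hull_sub xst; rewrite ?fsubsetIl ?fsubsetIr.
  move=> [xs xt]; have [w wx ws] := represents_conv sk xs.
  have [w' w'x wt] := represents_conv tk xt.
  rewrite -(represents_uniq l_neg l_coord HV wx w'x) in wt.
  have Sx : pl_sphere R m x by apply: (@skeleton_sphere k); exists s.
  by apply: conv_hull_sub (conv_support wx Sx); rewrite fsubsetI ws.
Qed.

Lemma small_perturbation (x y : vec) :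
  exists2 e : R, 0 < e & cell l x \subset cell l (x + e *: y).
Proof.
have H : \forall e \near (0 : R)^'+, forall i, i \in cell l x ->
    i \in cell l (x + e *: y).
  apply: filter_forall => i; have [ix|ix] := boolP (i \in cell l x); last first.
    by apply: nearW.
  move: ix; rewrite inE => ix.
  have b0 : 0 < `|eval_at l i y| + 1 by rewrite ltr_wpDl.
  near=> e => _; rewrite inE eval_atD eval_atZ.
  have e0 : 0 < e by near: e; exact: nbhs_right_gt.
  have : e < eval_at l i x / (`|eval_at l i y| + 1).
    by near: e; apply: nbhs_right_lt; rewrite divr_gt0.
  rewrite ltr_pdivlMr // mulrDr mulr1 => lt.
  have : - (e * `|eval_at l i y|) <= e * eval_at l i y.
    by rewrite -mulrN ler_wpM2l ?(ltW e0) // lerNl ler_normr lexx orbT.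
  by lra.
near (0 : R)^'+ => e.
exists e; first by near: e; exact: nbhs_right_gt.
by apply/fintype.subsetP; near: e.
Unshelve. all: by end_near. Qed.

(* Move from e_0 a little towards e_1, then a little towards e_2, and so on. *)
Lemma long_chain k : (k <= m)%N -> exists s x, [/\ (s `<=` V)%fset, chain l s,
  #|` s| = k.+1, {in s, forall v, cell l v \subset cell l x} &
  (forall j, 0 <= x ord0 j) /\
  (forall j : 'I_m.+2, (k < j)%N -> x ord0 j = 0)].
Proof.
pose e_ j : vec := delta_mx ord0 j.
have top (x : vec) : cell l x != finset.set0 -> (forall j, 0 <= x ord0 j) ->
    x ord0 ord_max = 0 -> exists2 t, t \in V & cell l t = cell l x.
  move=> cx x0 xm; apply: (orthant_boundary_vertex HV) => //.
  by split=> //; exists ord_max.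
have coord_cell (x : vec) j : 0 < x ord0 j -> exists2 i, i \in cell l x &
    forall y, eval_at l i y = y ord0 j.
  by move=> xj; have [i iP] := l_coord j; exists i; rewrite // inE iP.
elim: k => [|k IH] km.
  have e00 : 0 < e_ ord0 ord0 ord0 by rewrite mxE eqxx.
  have e0 j : 0 <= e_ ord0 ord0 j by rewrite mxE; case: eqP.
  have [i ie _] := coord_cell _ _ e00.
  have [||| t tV te] := top (e_ ord0).
  - by apply/finset.set0Pn; exists i.
  - exact: e0.
  - by rewrite mxE.
  exists [fset t]%fset, (e_ ord0); split.
  - by rewrite fsub1set.
  - by move=> u v; rewrite !inE => /eqP -> /eqP ->; rewrite subxx.
  - by rewrite cardfs1.
  - by move=> v; rewrite inE => /eqP ->; rewrite te.
  - by split=> // j j0; rewrite mxE eqxx /= -(inj_eq val_inj) /= gtn_eqF.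
have [s [x [sV chs sk sx [x0 xk]]]] := IH (ltnW km).
have kb : (k.+1 < m.+2)%N by rewrite ltnS ltnW // ltnS.
pose j0 : 'I_m.+2 := Ordinal kb.
have [e e_gt0 xy] := small_perturbation x (e_ j0).
set y := x + e *: e_ j0 in xy.
have yE j : y ord0 j = x ord0 j + e * (j == j0)%:R by rewrite !mxE eqxx.
have y0 j : 0 <= y ord0 j.
  by rewrite yE addr_ge0 // mulr_ge0 ?ler0n // ltW.
have yk (j : 'I_m.+2) : (k.+1 < j)%N -> y ord0 j = 0.
  move=> kj; rewrite yE xk ?(ltnW kj) // add0r -(inj_eq val_inj) /= gtn_eqF //.
  by rewrite mulr0.
have yj0 : 0 < y ord0 j0.
  by rewrite yE eqxx mulr1 ltr_wpDl.
have [i iy iP] := coord_cell _ _ yj0.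
have [|| t tV ty] := top y _ y0.
- by apply/finset.set0Pn; exists i.
- by rewrite yk.
(* The coordinate [j0] is positive at [t] but vanishes at [x], and so on the old chain. *)
have ts : t \notin s.
  apply/negP => /sx; rewrite ty => /fintype.subsetP/(_ i iy).
  by rewrite inE iP xk ?ltxx.
have sy v : v \in s -> cell l v \subset cell l y.
  by move=> /sx vx; exact: fintype.subset_trans vx xy.
exists (t |` s)%fset, y; split; last by split.
- by rewrite fsubUset fsub1set tV.
- move=> u v /fset1UP[->|us] /fset1UP[->|vs].
  + by rewrite subxx.
  + by rewrite ty (sy v vs) orbT.
  + by rewrite ty (sy u us).
  + exact: chs.
- by rewrite cardfsU1 ts sk.
- by move=> v /fset1UP[->|/sy //]; rewrite ty.
Qed.

(** [n_polyhedron] asks for the exact dimension, so a chain of full length has to be exhibited. *)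
Lemma skeleton_dim k : (k <= m)%N ->
  (\max_(s <- skeleton k.+1) #|` s|)%N = k.+1.
Proof.
move=> km; apply/eqP; rewrite eqn_leq; apply/andP; split.
  by apply/bigmax_leqP_seq => s /skeletonP[].
have [s [x [sV chs sk _ _]]] := long_chain km.
rewrite -{1}sk; apply: (@leq_bigmax_seq _ _ xpredT (fun s : {fset vec} => #|` s|)) => //.
apply/skeletonP; split=> //; last by rewrite sk.
by rewrite -cardfs_gt0 sk.
Qed.

End Skeleton.

(** * The retraction *)

Section BigMinMax.
Context {R : realType}.

Lemma continuous_bigmin (T : topologicalType) (J : Type) (r : seq J)
    (c : T -> R) (f : J -> T -> R) :
  continuous c -> (forall i, continuous (f i)) ->
  continuous (fun x => \big[Num.min/c x]_(i <- r) f i x).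
Proof.
move=> cc fc; elim: r => [|i r IH] x.
  by under eq_fun do rewrite big_nil; exact: cc.
under eq_fun do rewrite big_cons.
exact: (continuous_min (fc i x) (IH x)).
Qed.

Lemma continuous_bigmax (T : topologicalType) (J : Type) (r : seq J)
    (c : T -> R) (f : J -> T -> R) :
  continuous c -> (forall i, continuous (f i)) ->
  continuous (fun x => \big[Num.max/c x]_(i <- r) f i x).
Proof.
move=> cc fc; elim: r => [|i r IH] x.
  by under eq_fun do rewrite big_nil; exact: cc.
under eq_fun do rewrite big_cons.
exact: (continuous_max (fc i x) (IH x)).
Qed.

Lemma bigmin_seqP (J : eqType) (r : seq J) (c : R) (f : J -> R) :
  let M := \big[Num.min/c]_(i <- r) f i in
  [/\ M <= c, {in r, forall i, M <= f i} & M = c \/ exists2 i, i \in r & M = f i].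
Proof.
elim: r => [|i r [Mc Mf ME]] /=.
  by rewrite big_nil; split=> //; left.
rewrite big_cons; split.
- by rewrite ge_min Mc orbT.
- by move=> j; rewrite inE ge_min => /orP[/eqP ->|/Mf ->]; rewrite ?lexx ?orbT.
- case: (leP (f i)) => _; first by right; exists i; rewrite ?mem_head.
  by case: ME => [->|[j jr ->]]; [left | right; exists j; rewrite // inE jr orbT].
Qed.

Lemma bigmax_seqP (J : eqType) (r : seq J) (c : R) (f : J -> R) :
  let M := \big[Num.max/c]_(i <- r) f i in
  [/\ c <= M, {in r, forall i, f i <= M} & M = c \/ exists2 i, i \in r & M = f i].
Proof.
elim: r => [|i r [Mc Mf ME]] /=.
  by rewrite big_nil; split=> //; left.
rewrite big_cons; split.
- by rewrite le_max Mc orbT.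
- by move=> j; rewrite inE le_max => /orP[/eqP ->|/Mf ->]; rewrite ?lexx ?orbT.
- case: (leP (f i)) => _; last by right; exists i; rewrite ?mem_head.
  by case: ME => [->|[j jr ->]]; [left | right; exists j; rewrite // inE jr orbT].
Qed.

Definition min_coord m (x : 'rV[R]_m.+1) : R :=
  \big[Num.min/x ord0 ord0]_(j <- enum 'I_m.+1) x ord0 j.

Lemma min_coord_le m (x : 'rV[R]_m.+1) j : min_coord x <= x ord0 j.
Proof.
have [_ + _] := bigmin_seqP (enum 'I_m.+1) (x ord0 ord0) (fun j => x ord0 j).
by apply; rewrite mem_enum.
Qed.

Lemma min_coord_attained m (x : 'rV[R]_m.+1) :
  exists j, x ord0 j = min_coord x.
Proof.
have [_ _] := bigmin_seqP (enum 'I_m.+1) (x ord0 ord0) (fun j => x ord0 j).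
by case=> [E|[j _ E]]; [exists ord0 | exists j]; rewrite -E.
Qed.

Lemma min_coord_continuous m : continuous (@min_coord m).
Proof. by apply: continuous_bigmin => [|j]; exact: coord_continuous. Qed.

Definition drop_min m (x : 'rV[R]_m.+1) : 'rV[R]_m.+1 :=
  x - min_coord x *: const_mx 1.

Lemma drop_minE m (x : 'rV[R]_m.+1) j :
  drop_min x ord0 j = x ord0 j - min_coord x.
Proof. by rewrite !mxE mulr1. Qed.

Lemma drop_min_continuous m : continuous (@drop_min m).
Proof.
apply: continuous_row => j x.
rewrite (_ : (fun x => drop_min x ord0 j) = (fun x => x ord0 j - min_coord x)).
  apply: continuousB; first exact: coord_continuous.
  exact: min_coord_continuous.
by apply/funext => y; rewrite drop_minE.
Qed.

Lemma drop_min_boundary m (x : 'rV[R]_m.+2) : orthant_boundary (drop_min x).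
Proof.
split=> [j|]; first by rewrite drop_minE subr_ge0 min_coord_le.
by have [j xj] := min_coord_attained x; exists j; rewrite drop_minE xj subrr.
Qed.

Lemma drop_min_id m (x : 'rV[R]_m.+2) : orthant_boundary x -> drop_min x = x.
Proof.
move=> [x0 [k xk]]; suff E : min_coord x = 0.
  by rewrite /drop_min E scale0r subr0.
apply/eqP; rewrite eq_le -{1}xk min_coord_le /=.
by have [j <-] := min_coord_attained x.
Qed.

End BigMinMax.

Section Retraction.
Context {R : realType} (m : nat) (I : finType) (l : I -> 'cV[R]_m.+2).
Local Notation vec := 'rV[R]_m.+2.
Hypothesis l_neg :
  forall i, exists i', forall x, eval_at l i' x = - eval_at l i x.
Hypothesis l_coord : forall k, exists i, forall x, eval_at l i x = x ord0 k.
Variable V : {fset vec}.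
Hypothesis HV : cell_vertices l V.

(** There is exactly one choice, also on the diagonal, where all weights are 0. *)
Definition weights (x : vec) : vec -> R :=
  xget (fun=> 0) [set w | represents l V w (drop_min x)].

Lemma weightsP x : represents l V (weights x) (drop_min x).
Proof.
have := represents_exists l_neg l_coord HV (drop_min_boundary x).
exact: xgetPex.
Qed.

Lemma weights_ge0 x v : 0 <= weights x v.
Proof. by case: (weightsP x). Qed.

(* On the closed set of points whose weights are supported in a given chain,
   the weights are given by linear functionals. *)
Lemma weights_continuous v : continuous (fun x => weights x v).
Proof.
(* Dual functionals for all chains at once, with the irrelevant value 0 for other sets. *)
have /choice[phi phiP] : forall su : {fset vec} * vec,
    exists p : 'cV[R]_m.+2,
    (su.1 `<=` V)%fset -> chain l su.1 -> su.2 \in su.1 ->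
    {in su.1, forall u, (u *m p) ord0 ord0 = (u == su.2)%:R}.
  move=> [s u] /=.
  have [[sV [chs us]]|nH] := pselect ((s `<=` V)%fset /\ chain l s /\ u \in s).
    by have [p pP] := chain_dual l_neg l_coord HV sV chs us; exists p.
  by exists 0 => sV chs us; exfalso; apply: nH.
pose co s u (x : vec) : R := (drop_min x *m phi (s, u)) ord0 ord0.
have co_cont s u : continuous (co s u).
  move=> x; apply: (@continuous_comp _ _ _ (@drop_min R _)
    (fun y : vec => (y *m phi (s, u)) ord0 ord0)).
    exact: drop_min_continuous.
  apply: (@continuous_comp _ _ _ (fun y : vec => y *m phi (s, u))
    (fun y : 'rV[R]_1 => y ord0 ord0)).
    exact: mulmx_continuous.
  exact: coord_continuous.
have coE (s : {fset vec}) (w : vec -> R) x u : (s `<=` V)%fset -> chain l s ->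
    u \in s -> drop_min x = \sum_(v <- s) w v *: v -> co s u x = w u.
  move=> sV chs us xE; rewrite /co xE mulmx_suml summxE (big_fsetD1 u) //=.
  rewrite -scalemxAl mxE phiP //= eqxx mulr1 big_seq big1 ?addr0 // => t.
  rewrite in_fsetD1 => /andP[tu ts].
  by rewrite -scalemxAl mxE phiP //= (negbTE tu) mulr0.
(* Stated through the linear candidates [co] and not through [weights], so that closedness follows
   from the continuity of the candidates. *)
pose C (s : fpowerset V) : set vec := [set x | chain l (val s) /\
  ((forall u, u \in val s -> 0 <= co (val s) u x) /\
   (forall j, drop_min x ord0 j =
      \sum_(u <- val s) co (val s) u x * u ord0 j))].
have sV (s : fpowerset V) : (val s `<=` V)%fset by rewrite -fpowersetE (valP s).
apply: (@continuous_closed_cover _ _ _ C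
  (fun s x => if v \in val s then co (val s) v x else 0)).
- move=> s; have [chs|nch] := pselect (chain l (val s)); last first.
    rewrite (_ : C s = classical_sets.set0); first exact: closed0.
    by apply/seteqP; split=> // x [].
  have -> : C s = (\bigcap_(u in [set u | u \in val s])
        [set x | 0 <= co (val s) u x]) `&`
      \bigcap_(j in setT) [set x | drop_min x ord0 j -
        \sum_(u <- val s) co (val s) u x * u ord0 j = 0].
    apply/seteqP; split=> x.
      move=> [_ [H1 H2]]; split; first by move=> u us; exact: H1.
      by move=> j _ /=; rewrite H2 subrr.
    move=> [H1 H2]; split=> //; split; first by move=> u us; exact: H1.
    by move=> j; apply/eqP; rewrite -subr_eq0; apply/eqP; exact: (H2 j).
  apply: closedI; [apply: closed_bigI => u _|apply: closed_bigI => j _].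
    apply: (@closed_comp _ _ (co (val s) u) [set y | 0 <= y]).
      by move=> x _; exact: co_cont.
    exact: closed_ge.
  apply: (@closed_comp _ _ (fun x => drop_min x ord0 j -
        \sum_(u <- val s) co (val s) u x * u ord0 j) [set y | y = 0]).
    move=> x _; apply: continuousB.
      apply: (@continuous_comp _ _ _ (@drop_min R _) (fun y : vec => y ord0 j)).
        exact: drop_min_continuous.
      exact: coord_continuous.
    apply: continuous_big => [|u _ y]; first exact: add_continuous.
    by apply: continuousM; [exact: co_cont | exact: cst_continuous].
  exact: closed_eq.
- move=> s; case: (v \in val s); first exact: co_cont.
  exact: cst_continuous.
- move=> x; have wx := weightsP x.
  have sP : support V (weights x) \in fpowerset V.
    by rewrite fpowersetE support_sub.
  have chs := support_chain wx.
  exists [` sP]%fset; rewrite /C /=.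
  have xE : drop_min x = \sum_(u <- support V (weights x)) weights x u *: u.
    rewrite sum_support => [|u ->]; last by rewrite scale0r.
    by case: wx.
  have coW u : u \in support V (weights x) ->
      co (support V (weights x)) u x = weights x u.
    by move=> us; apply: coE => //; exact: support_sub.
  split=> //; split=> [u us|j]; first by rewrite coW // weights_ge0.
  rewrite xE summxE [LHS]big_seq [RHS]big_seq; apply: eq_bigr => u us.
  by rewrite mxE coW.
- move=> s x [chs [c0 xE]].
  have := chain_represents (sV s) chs c0.
  rewrite (_ : \sum_(u <- _) _ = drop_min x); last first.
    apply/rowP => j; rewrite xE summxE; apply: eq_bigr => u _.
    by rewrite mxE.
  by move/(represents_uniq l_neg l_coord HV (weightsP x)) => ->.
Qed.

(** * Truncating the weights *)

Section Truncate.
Variable k : nat.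

Definition candidates : seq {fset vec} :=
  [seq A <- enum_fset (fpowerset V) | (#|` A| == k.+1)%N].

Definition total x : R := \sum_(v <- V) weights x v.

(** The default [total x] bounds every weight, so it does not affect the minimum over a nonempty [A]
    inside [V]. Maximizing over all [A] with [k.+1] elements finds the (k+1)-st largest weight
    without sorting, in a form that is visibly continuous. *)
Definition least_weight x (A : {fset vec}) : R :=
  \big[Num.min/total x]_(v <- A) weights x v.

(* The (k+1)-st largest weight. *)
Definition threshold (x : vec) : R :=
  \big[Num.max/0]_(A <- candidates) least_weight x A.

Definition excess x v : R := Num.max (weights x v - threshold x) 0.

Definition mass x : R := \sum_(v <- V) excess x v.

Definition retract x : vec := (mass x)^-1 *: \sum_(v <- V) excess x v *: v.

Lemma threshold_continuous : continuous threshold.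
Proof.
apply: continuous_bigmax => [|A]; first exact: cst_continuous.
apply: continuous_bigmin => [|v]; last exact: weights_continuous.
apply: continuous_big => [|v _]; first exact: add_continuous.
exact: weights_continuous.
Qed.

Lemma excess_continuous v : continuous (fun x => excess x v).
Proof.
move=> x; apply: (@continuous_max R _ (fun x => weights x v - threshold x)
  (fun=> 0)); last exact: cst_continuous.
apply: continuousB; first exact: weights_continuous.
exact: threshold_continuous.
Qed.

Lemma mass_continuous : continuous mass.
Proof.
apply: continuous_big => [|v _]; first exact: add_continuous.
exact: excess_continuous.
Qed.

Lemma retract_continuous x : mass x != 0 -> {for x, continuous retract}.
Proof.
move=> m0.
have c1 : {for x, continuous (fun y => (mass y)^-1)}.
  by apply: continuousV => //; exact: mass_continuous.
have c2 : {for x, continuous (fun y => \sum_(v <- V) excess y v *: v)}.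
  exact: (row_continuous_lincomb excess_continuous).
exact: (continuousZ c1 c2).
Qed.

Lemma excess_ge0 x v : 0 <= excess x v.
Proof. by rewrite le_max lexx orbT. Qed.

Lemma threshold_ge0 x : 0 <= threshold x.
Proof. by have [] := bigmax_seqP candidates 0 (least_weight x). Qed.

Lemma excess_neq0 x v : excess x v != 0 -> threshold x < weights x v.
Proof.
rewrite ltNge; apply: contraNN => le; apply/eqP/max_idPr.
by rewrite subr_le0.
Qed.

Lemma excess_weights x v : excess x v != 0 -> weights x v != 0.
Proof.
move/excess_neq0 => lt; rewrite gt_eqF //.
exact: le_lt_trans (threshold_ge0 x) lt.
Qed.

Lemma represents_retract x : mass x != 0 ->
  represents l V (fun v => (mass x)^-1 * excess x v) (retract x).
Proof.
move=> m0; have [_ wV wch _] := weightsP x.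
have nz v : (mass x)^-1 * excess x v != 0 -> weights x v != 0.
  by rewrite mulf_eq0 negb_or => /andP[_]; exact: excess_weights.
split.
- move=> v; rewrite mulr_ge0 ?excess_ge0 // invr_ge0.
  by apply: sumr_ge0 => u _; exact: excess_ge0.
- by move=> v /nz /wV.
- by move=> u v /nz wu /nz wv; exact: wch.
- by rewrite /retract scaler_sumr; apply: eq_bigr => v _; rewrite scalerA.
Qed.

(** Consequently at most [k] vertices have positive excess, which is what puts the retraction into
    the skeleton. *)
Lemma threshold_ge x (A : {fset vec}) : (A `<=` V)%fset -> #|` A| = k.+1 ->
  exists2 v, v \in A & weights x v <= threshold x.
Proof.
move=> AV Ak.
have [_ /(_ A) H _] := bigmax_seqP candidates 0 (least_weight x).
have {H} := H _; rewrite mem_filter Ak eqxx fpowersetE => /(_ AV) H.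
have [_ _ [E|[v vA E]]] := bigmin_seqP A (total x) (weights x).
  have /fset0Pn[v vA] : A != fset0 by rewrite -cardfs_gt0 Ak.
  exists v => //; apply: le_trans H; rewrite /least_weight E /total (big_fsetD1 v) /=.
    by rewrite lerDl; apply: sumr_ge0 => u _; exact: weights_ge0.
  exact: (fsubsetP AV).
by exists v => //; rewrite -E; exact: H.
Qed.

Lemma threshold_cases x : threshold x = 0 \/
  exists A : {fset vec}, [/\ (A `<=` V)%fset, #|` A| = k.+1 &
    {in A, forall v, threshold x <= weights x v}].
Proof.
have [_ _ [E|[A]]] := bigmax_seqP candidates 0 (least_weight x).
  by left; rewrite /threshold E.
rewrite mem_filter fpowersetE => /andP[/eqP Ak AV] E; right; exists A; split=> //.
move=> v vA; rewrite /threshold E.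
have [_ H _] := bigmin_seqP A (total x) (weights x).
exact: H.
Qed.

Lemma retract_skeleton x : mass x != 0 ->
  Defs.space (skeleton l V k) (retract x).
Proof.
move=> m0; have rep := represents_retract m0.
have r1 : \sum_j retract x ord0 j = 1.
  by rewrite (represents_mass HV rep) -mulr_sumr mulVf.
have [u wu] : exists u, (mass x)^-1 * excess x u != 0.
  apply: contrapT => /forallNP w0; have := represents_mass HV rep.
  rewrite r1 big1 => [/eqP|v _]; first by rewrite oner_eq0.
  by apply/eqP; have /negP := w0 v; rewrite negbK.
have [t [tV _ tx _]] := represents_top l_neg rep wu.
have [r0 rk] : orthant_boundary (retract x).
  apply: (cell_orthant_boundary l_neg l_coord (y := t)); first by rewrite tx.
  exact/sphere_orthant_boundary/(vertex_sphere HV).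
apply: (in_skeleton HV rep) => //.
rewrite leqNgt; apply/negP => /fsubset_card[A AS Ak].
have [|v vA] := threshold_ge x _ Ak.
  exact: fsubset_trans AS (support_sub _ _).
have := fsubsetP AS v vA; rewrite in_support mulf_eq0 negb_or.
by move=> /and3P[_ _ /excess_neq0]; rewrite ltNge => /negP.
Qed.

(** At most [k] weights are positive on the skeleton, so the threshold is 0 and nothing is cut off.
    The value of the mass is recorded for use as a cutoff. *)
Lemma retract_id x : Defs.space (skeleton l V k) x ->
  mass x = 1 /\ retract x = x.
Proof.
move=> xS; have Sx := skeleton_sphere l_neg l_coord HV xS.
have wx := weightsP x; rewrite drop_min_id in wx; last first.
  exact: sphere_orthant_boundary.
have le_k := skeleton_support l_neg l_coord HV wx xS.
have t0 : threshold x = 0.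
  case: (threshold_cases x) => // -[A [AV Ak tA]].
  apply/eqP; rewrite eq_le threshold_ge0 andbT leNgt; apply/negP => tx.
  suff : (#|` A| <= #|` support V (weights x)|)%N.
    by rewrite Ak leqNgt ltnS le_k.
  apply: fsubset_leq_card; apply/fsubsetP => v vA.
  by rewrite in_support (fsubsetP AV) // gt_eqF // (lt_le_trans tx) // tA.
have eE v : excess x v = weights x v.
  by rewrite /excess t0 subr0; apply/max_idPl; exact: weights_ge0.
have m1 : mass x = 1.
  rewrite /mass (eq_bigr (weights x)) => [|v _]; last exact: eE.
  by rewrite -(represents_mass HV wx); case: Sx.
split=> //; rewrite /retract m1 invr1 scale1r.
by case: wx => _ _ _ {2}->; apply: eq_bigr => v _; rewrite eE.
Qed.

Definition bad_rows (s A : {fset vec}) : seq vec :=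
  const_mx 1 :: \sum_(v <- A) v :: enum_fset (s `\` A)%fset.

(** The default 0 of [nth] pads short lists with zero rows, so that all the subspaces form one
    family of matrices of the same size. Lists that are too long get cut, but only short ones are
    put to use. *)
Definition bad_space (sA : fpowerset V * fpowerset V) :
    'M[R]_((m.+2 - k)%N, m.+2) :=
  \matrix_i nth 0 (bad_rows (val sA.1) (val sA.2)) i.

Lemma sum_nth_pad c (a : seq R) (r : seq vec) :
  size a = size r -> (size r <= c)%N ->
  (\row_(i < c) nth 0 a i) *m (\matrix_(i < c) nth 0 r i) =
  \sum_(i < size r) nth 0 a i *: nth 0 r i.
Proof.
move=> ar rc; rewrite mulmx_sum_row (big_ord_widen_cond c xpredT
  (fun i => nth 0 a i *: nth 0 r i) rc).
rewrite [RHS]big_mkcond /=; apply: eq_bigr => i _; rewrite rowK mxE.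
by case: ifP => // /negbT; rewrite -leqNgt => ri; rewrite [nth 0 r i]nth_default ?scaler0.
Qed.

(* Off the domain of the retraction the largest k+1 weights coincide, so the
   point is a combination of (1, .., 1), of the sum of those k+1 vertices,
   and of the remaining vertices of the chain, at most m - k of them. *)
Lemma mass_eq0 x : (k <= m)%N -> mass x = 0 ->
  exists sA p, x = p *m bad_space sA.
Proof.
move=> km mx0; have [w0 wV wch xE] := weightsP x.
have wle v : weights x v <= threshold x.
  have [vV|vV] := boolP (v \in V); last first.
    suff -> : weights x v = 0 by exact: threshold_ge0.
    by apply/eqP; apply: contraNT vV; exact: wV.
  have e0 : excess x v = 0.
    apply/eqP; move/eqP: mx0; rewrite /mass psumr_eq0 => [/allP/(_ v vV)|u _] //.
    exact: excess_ge0.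
  by rewrite -subr_le0 -e0 /excess le_max lexx.
have xD : x = drop_min x + min_coord x *: const_mx 1 by rewrite subrK.
have build (s A : {fset vec}) t : (s `<=` V)%fset -> (A `<=` V)%fset ->
    (#|` (s `\` A)%fset|.+2 <= m.+2 - k)%N ->
    drop_min x = t *: \sum_(v <- A) v +
      \sum_(v <- (s `\` A)%fset) weights x v *: v ->
    exists sA p, x = p *m bad_space sA.
  move=> sV AV sz dE.
  have sP : s \in fpowerset V by rewrite fpowersetE.
  have AP : A \in fpowerset V by rewrite fpowersetE.
  exists ([` sP]%fset, [` AP]%fset).
  exists (\row_i nth 0 [:: min_coord x, t &
    [seq weights x v | v <- enum_fset (s `\` A)%fset]] i).
  rewrite /bad_space sum_nth_pad /bad_rows /= ?size_map // !big_ord_recl /=.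
  rewrite [LHS]xD dE addrC; congr (_ + (_ + _)).
  rewrite (big_nth 0) big_mkord; apply: eq_bigr => i _.
  by rewrite (nth_map 0) ?ltn_ord.
(* If the threshold is 0, all weights are 0 and [x] is a multiple of the all-ones row; empty sets
   suffice. *)
have [t0|tn] := eqVneq (threshold x) 0.
  apply: (build fset0 fset0 0) => //; rewrite ?fsub0set //.
    by rewrite fset0D /= leq_subRL; lia.
  rewrite fset0D !big_seq_fset0 scaler0 addr0 xE big1 // => v _.
  have -> : weights x v = 0.
    by apply/eqP; rewrite eq_le w0 andbT -t0 wle.
  by rewrite scale0r.
have [/eqP|[A [AV Ak tA]]] := threshold_cases x; first by rewrite (negbTE tn).
have t_gt0 : 0 < threshold x by rewrite lt0r tn threshold_ge0.
pose s := support V (weights x).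
have As : (A `<=` s)%fset.
  apply/fsubsetP => v vA; rewrite in_support (fsubsetP AV) // gt_eqF //.
  exact: lt_le_trans (tA v vA).
have chs : chain l s by exact: support_chain (weightsP x).
have sV : (s `<=` V)%fset by exact: support_sub.
(* A coordinate vanishing at [drop_min x] vanishes on its whole chain, which thus lies in a
   hyperplane. *)
have sm : (#|` s| <= m.+1)%N.
  have [_ [j xj]] := drop_min_boundary x.
  have := chain_rank l_neg l_coord HV (s := s)
    (N := delta_mx j (ord0 : 'I_1)) sV chs.
  rewrite mxrank_delta addn1 ltnS; apply=> v; rewrite in_support => /andP[_ wv].
  have [i iP] := l_coord j.
  have vj : v ord0 j = 0.
    rewrite -iP; apply: (cell_eq0 l_neg (represents_cell l_neg (weightsP x) wv)).
    by rewrite iP.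
  apply/rowP => c; rewrite mxE [RHS]mxE (bigD1 j) //= mxE vj mul0r add0r.
  by rewrite big1 // => c' /negbTE cj; rewrite mxE cj mulr0.
apply: (build s A (threshold x)) => //.
  (* Two rows precede the vertices outside [A], and [2 + (m + 1) - (k + 1)] is [m + 2 - k]. *)
  have := cardfsD s A; rewrite (fsetIidPr As) Ak => ->.
  by have := fsubset_leq_card As; rewrite Ak; lia.
rewrite xE -(sum_support V (w := weights x)) => [|v ->]; last by rewrite scale0r.
rewrite scaler_sumr (big_fsetID _ (mem A)) /=; congr (_ + _).
  rewrite (_ : [fset v in s | v \in A]%fset = A); last first.
    by rewrite -[RHS](fsetIidPr As); apply/fsetP => v; rewrite !inE.
  rewrite [LHS]big_seq [RHS]big_seq; apply: eq_bigr => v vA.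
  by congr (_ *: _); apply/eqP; rewrite eq_le wle tA.
by congr (\big[_/_]_(v <- enum_fset _) _); apply/fsetP => v; rewrite !inE andbC.
Qed.

End Truncate.
End Retraction.

(** * Connectivity *)

Section Clamp.
Context {R : realType}.

Definition clamp (t : R) : R := Num.max 0 (Num.min 1 t).

Lemma clamp_itv t : 0 <= clamp t <= 1.
Proof. by rewrite /clamp le_max lexx /= ge_max ler01 ge_min lexx. Qed.

Lemma clamp_id t : 0 <= t <= 1 -> clamp t = t.
Proof. by move=> /andP[t0 t1]; rewrite /clamp (min_idPr t1) (max_idPr t0). Qed.

Lemma clamp_le0 t : t <= 0 -> clamp t = 0.
Proof.
by move=> t0; rewrite /clamp (min_idPr (le_trans t0 ler01)) (max_idPl t0).
Qed.

Lemma clamp_ge1 t : 1 <= t -> clamp t = 1.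
Proof. by move=> t1; rewrite /clamp (min_idPl t1) (max_idPr ler01). Qed.

Lemma clamp_continuous (T : topologicalType) (g : T -> R) x :
  {for x, continuous g} -> {for x, continuous (fun y => clamp (g y))}.
Proof.
move=> gc; apply: (@continuous_max R _ (fun=> 0) (fun y => Num.min 1 (g y))).
  exact: cst_continuous.
apply: (@continuous_min R _ (fun=> 1) g) => //.
exact: cst_continuous.
Qed.

(** A spheroid is continuous only within the cube; composed with this retraction onto the cube it
    becomes continuous everywhere. *)
Definition clamp_cube i (u : 'rV[R]_i) : 'rV[R]_i := map_mx clamp u.

Lemma clamp_cube_in i (u : 'rV[R]_i) : unit_cube (clamp_cube u).
Proof. by move=> j; rewrite mxE clamp_itv. Qed.

Lemma clamp_cube_id i (u : 'rV[R]_i) : unit_cube u -> clamp_cube u = u.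
Proof. by move=> cu; apply/rowP => j; rewrite mxE clamp_id // cu. Qed.

Lemma clamp_cube_continuous i : continuous (@clamp_cube i).
Proof.
apply: continuous_row => j x.
rewrite (_ : (fun x => _) = (fun x : 'rV[R]_i => clamp (x ord0 j))).
  by apply: clamp_continuous; exact: coord_continuous.
by apply/funext => y; rewrite mxE.
Qed.

Lemma within_continuous_comp (S T U : topologicalType) (A : set T) (f : T -> U)
    (g : S -> T) : {within A, continuous f} -> continuous g ->
  (forall x, A (g x)) -> continuous (f \o g).
Proof.
move=> /subspace_continuousP fc gc Ag x W fW.
have := fc (g x) (Ag x) W fW; rewrite /= nbhs_simpl /within /= => H.
have := gc x _ H; rewrite /= nbhs_simpl /=.
by apply: filterS => y; apply.
Qed.

Lemma lsubmx_continuous p q : continuous (fun x : 'rV[R]_(p + q) => lsubmx x).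
Proof.
apply: continuous_row => j.
rewrite (_ : (fun x => _) = (fun x : 'rV[R]_(p + q) => x ord0 (lshift q j))).
  exact: coord_continuous.
by apply/funext => y; rewrite mxE.
Qed.

End Clamp.

Section Connectivity.
Context {R : realType} (m : nat) (I : finType) (l : I -> 'cV[R]_m.+2).
Local Notation vec := 'rV[R]_m.+2.
Hypothesis l_neg :
  forall i, exists i', forall x, eval_at l i' x = - eval_at l i x.
Hypothesis l_coord : forall k, exists i, forall x, eval_at l i x = x ord0 k.
Variable V : {fset vec}.
Hypothesis HV : cell_vertices l V.

Lemma skeleton_nonempty k : Defs.space (skeleton l V k.+1) !=set0.
Proof.
have [s [_ [sV _ s1 _ _]]] := long_chain l_coord HV (leq0n m).
have /fset0Pn[t ts] : s != fset0 by rewrite -cardfs_gt0 s1.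
have tV := fsubsetP sV t ts.
exists t, [fset t]%fset.
  apply/skeletonP; split.
  - by rewrite fsub1set.
  - by rewrite -cardfs_gt0 cardfs1.
  - by rewrite cardfs1.
  - by move=> u v; rewrite !inE => /eqP -> /eqP ->; rewrite subxx.
exists (fun=> 1); first by split=> //; rewrite big_seq_fset1.
by rewrite big_seq_fset1 scale1r.
Qed.

(* A straight-line homotopy is moved off the complement of the domain of
   the retraction, except near the skeleton, which is left in place. *)
Lemma skeleton_trivial_pi k i x0 : (k <= m)%N -> (i.+1 < k)%N ->
  Defs.space (skeleton l V k) x0 ->
  trivial_pi i (Defs.space (skeleton l V k)) x0.
Proof.
move=> km ik Xx0 f [fc fX fb].
pose X := Defs.space (skeleton l V k).
have gc : continuous (f \o @clamp_cube R i).
  apply: within_continuous_comp fc (@clamp_cube_continuous R i) _.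
  exact: clamp_cube_in.
pose tm (q : 'rV[R]_(i + 1)) : R := clamp (q ord0 (rshift i ord0)).
have tmc : continuous tm.
  by move=> q; apply: clamp_continuous; exact: coord_continuous.
(* Time is the last coordinate of [q], since general position is stated for a map on a single
   cube. *)
pose F q : vec := (1 - tm q) *: f (clamp_cube (lsubmx q)) + tm q *: x0.
have Fc : continuous F.
  move=> q.
  have c1 : {for q, continuous (fun q => (1 - tm q) *: f (clamp_cube (lsubmx q)))}.
    apply: continuousZ.
      by apply: continuousB; [exact: cst_continuous | exact: tmc].
    apply: (@continuous_comp _ _ _ (fun q : 'rV[R]_(i + 1) => lsubmx q)
      (f \o @clamp_cube R i)); [exact: lsubmx_continuous | exact: gc].
  have c2 : {for q, continuous (fun q => tm q *: x0)}.
    by apply: continuousZ; [exact: tmc | exact: cst_continuous].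
  exact: continuousD c1 c2.
have massc := mass_continuous l_neg l_coord HV (k := k).
have Kc : compact (F @` @unit_cube R (i + 1)).
  apply: continuous_compact (@unit_cube_compact R (i + 1)).
  exact: continuous_subspaceT.
have e0 : 0 < 4^-1 :> R by rewrite invr_gt0.
(* Moving a value of [F] by at most [d] changes its mass by at most 1/4. *)
have [d d0 dP] := uniform_on_compact Kc massc e0.
have dim : (i + 1 + (m.+2 - k) < m.+2)%N by lia.
have [G [Gc GF Gbad]] := general_position (@bad_space R m V k) dim Fc d0.
(* This is 0 where the mass is 1, in particular over the skeleton, and 1 where the mass is at most
   1/2, so that [Phi] is [G] there. Elsewhere the mass exceeds 1/2 and stays positive under a move
   of length at most [d]. *)
pose lam q := clamp (2 * (1 - mass l V k (F q))).
pose Phi q := F q + lam q *: (G q - F q).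
have Phi_mass q : unit_cube q -> mass l V k (Phi q) != 0.
  move=> cq; have [le2|gt2] := leP (mass l V k (F q)) 2^-1.
    have -> : Phi q = G q.
      rewrite /Phi /lam clamp_ge1 ?scale1r ?subrKC //.
      by lra.
    apply/eqP => /(mass_eq0 l_neg l_coord HV km)[sA [p]].
    exact: Gbad.
  have le_d : `|F q - Phi q| <= d.
    rewrite /Phi opprD addrA subrr add0r normrN normrZ.
    have /andP[l0 l1] := clamp_itv (2 * (1 - mass l V k (F q))).
    rewrite ger0_norm //; apply: le_trans (GF q cq).
    by rewrite ler_piMl.
  have := dP _ _ _ le_d; rewrite ler_norml => /(_ _)/andP[|_ H].
    by exists q.
  by rewrite gt_eqF //; lra.
have Phi_fix q : X (F q) -> retract l V k (Phi q) = F q.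
  move=> XF; have [m1 rE] := retract_id l_neg l_coord HV XF.
  have -> : Phi q = F q.
    by rewrite /Phi /lam m1 subrr mulr0 clamp_le0 // scale0r addr0.
  exact: rE.
have Phic : continuous Phi.
  move=> q.
  have c1 : {for q, continuous lam}.
    apply: clamp_continuous; apply: continuousM; first exact: cst_continuous.
    apply: continuousB; first exact: cst_continuous.
    exact: (@continuous_comp _ _ _ F (mass l V k) q (Fc q) (massc (F q))).
  have c2 : {for q, continuous (fun q => G q - F q)}.
    exact: continuousB (Gc q) (Fc q).
  exact: continuousD (Fc q) (continuousZ c1 c2).
pose join (ut : 'rV[R]_i * R) : 'rV[R]_(i + 1) := row_mx ut.1 (const_mx ut.2).
have joinc : continuous join.
  apply: continuous_row => j; have [j' ->|j' ->] := split_ordP j.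
    rewrite (_ : (fun x => _) = (fun x : 'rV[R]_i * R => x.1 ord0 j')).
      move=> x; apply: (@continuous_comp _ _ _ fst (fun y : 'rV[R]_i => y ord0 j')).
        exact: cvg_fst.
      exact: coord_continuous.
    by apply/funext => x; rewrite row_mxEl.
  rewrite (_ : (fun x => _) = (fun x : 'rV[R]_i * R => x.2)).
    by move=> x; exact: cvg_snd.
  by apply/funext => x; rewrite row_mxEr mxE.
have join_cube u t : unit_cube u -> 0 <= t <= 1 -> unit_cube (join (u, t)).
  move=> cu ct j; have [j' ->|j' ->] := split_ordP j.
    by rewrite row_mxEl; exact: cu.
  by rewrite row_mxEr mxE.
have F_join u t : unit_cube u -> 0 <= t <= 1 ->
    F (join (u, t)) = (1 - t) *: f u + t *: x0.
  move=> cu ct; rewrite /F /tm /join row_mxKl clamp_cube_id //=.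
  by rewrite row_mxEr mxE clamp_id.
exists (fun ut => retract l V k (Phi (join ut))); split.
- apply: continuous_in_subspaceT => -[u t]; rewrite inE /= => -[cu].
  rewrite /= in_itv /= => ct.
  apply: (@continuous_comp _ _ _ (Phi \o join) (retract l V k)).
    by apply: continuous_comp; [exact: joinc | exact: Phic].
  apply: (retract_continuous l_neg l_coord HV).
  exact: Phi_mass (join_cube u t cu ct).
- move=> u t cu ct; apply: (retract_skeleton l_neg l_coord HV).
  exact: Phi_mass (join_cube u t cu ct).
- move=> u cu; have E : F (join (u, 0)) = f u.
    by rewrite F_join ?lexx ?ler01 // subr0 scale1r scale0r addr0.
  by rewrite Phi_fix E //; exact: fX.
- move=> u cu; have E : F (join (u, 1)) = x0.
    by rewrite F_join ?lexx ?ler01 // subrr scale1r scale0r add0r.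
  by rewrite Phi_fix E.
- move=> u t bu ct; have E : F (join (u, t)) = x0.
    by rewrite (F_join _ _ (proj1 bu) ct) (fb u bu) -scalerDl subrK scale1r.
  by rewrite Phi_fix E.
Qed.

End Connectivity.

(** * Hyperplanes through given subspaces *)

Section Functionals.
Context {R : realType} (m c : nat) (J : finType) (D : J -> 'M[R]_(c, m.+2)).

Definition functional_index : finType :=
  (bool * ('I_m.+2 + J * 'I_m.+2))%type.

(* Up to sign: the coordinates, and equations of the row space of each [D j]. *)
Definition functional (i : functional_index) : 'cV[R]_m.+2 :=
  (-1) ^+ i.1 *: match i.2 with
    | inl k => delta_mx k ord0
    | inr (j, k) => col k (cokermx (D j))
    end.

Lemma functional_neg i : exists i', forall x : 'rV[R]_m.+2,
  eval_at functional i' x = - eval_at functional i x.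
Proof.
case: i => b a; exists (~~ b, a) => x.
by rewrite /eval_at /functional /= signrN scaleNr mulmxN mxE.
Qed.

Lemma functional_coord k : exists i, forall x : 'rV[R]_m.+2,
  eval_at functional i x = x ord0 k.
Proof.
exists (false, inl k) => x.
rewrite /eval_at /functional /= expr0 scale1r mxE (bigD1 k) //=.
rewrite mxE !eqxx mulr1 big1 ?addr0 // => j /negbTE jk.
by rewrite mxE jk mulr0.
Qed.

Lemma eval_at_coker j k (x : 'rV[R]_m.+2) :
  eval_at functional (false, inr (j, k)) x = (x *m cokermx (D j)) ord0 k.
Proof.
rewrite /eval_at /functional /= expr0 scale1r !mxE.
by apply: eq_bigr => i _; rewrite mxE.
Qed.

(** The equations of [D j] vanish at [y], hence on every vertex of its chain. The chain is an
    independent set in a space of dimension at most [n], so it has at most [n] members. *)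
Lemma rowspace_in_skeleton (V : {fset 'rV[R]_m.+2}) n j y :
  cell_vertices functional V -> (\rank (D j) <= n)%N ->
  (y <= D j)%MS -> pl_sphere R m y ->
  Defs.space (skeleton functional V n) y.
Proof.
move=> HV Dn yD Sy.
have wy := weightsP functional_neg functional_coord HV y.
rewrite drop_min_id in wy; last exact: sphere_orthant_boundary.
apply: (in_skeleton HV wy Sy).
have yN : y *m cokermx (D j) = 0.
  by apply/eqP; rewrite -submxE.
have := chain_rank functional_neg functional_coord HV (N := cokermx (D j))
  (support_sub V _) (support_chain wy).
rewrite mxrank_coker => H.
have {H} : (#|` support V (weights functional V y)|
    + (m.+2 - \rank (D j)) <= m.+2)%N.
  apply: H => v; rewrite in_support => /andP[_ wv].
  apply/rowP => k; rewrite [RHS]mxE -eval_at_coker.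
  apply: (cell_eq0 functional_neg (represents_cell functional_neg wy wv)).
  by rewrite eval_at_coker yN mxE.
have := rank_leq_col (D j).
by lia.
Qed.

End Functionals.

(** * Spans of images of simplices *)

Section ImageSpan.
Context {R : realType} (N : nat).
Implicit Types (s : {fset 'rV[R]_N}) (w : 'rV[R]_N -> R).

(** Homogeneous coordinates: affine independence becomes linear independence. *)
Definition lift1 (x : 'rV[R]_N) : 'rV[R]_(N + 1) := row_mx x (const_mx 1).

Lemma sum_lift1 s w : \sum_(v <- s) w v *: lift1 v =
  row_mx (\sum_(v <- s) w v *: v) (const_mx (\sum_(v <- s) w v)).
Proof.
elim: (enum_fset s) => [|v r IH].
  by rewrite !big_nil (_ : const_mx 0 = 0) ?row_mx0 //; apply/rowP => j; rewrite !mxE.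
rewrite !big_cons IH scale_row_mx add_row_mx; congr row_mx.
by apply/rowP => j; rewrite !mxE mulr1.
Qed.

Lemma lifted_row_free s : affinely_independent s ->
  row_free (image_rows lift1 s).
Proof.
move=> si; apply: inj_row_free => x; have [w ->] := weight_rowP x.
rewrite mul_image_rows sum_lift1 => /eqP; rewrite row_mx_eq0 => /andP[/eqP x0 w0].
have {}w0 : \sum_(v <- s) w v = 0.
  by move/eqP/rowP/(_ ord0): w0; rewrite !mxE.
by apply/rowP => i; rewrite !mxE (si w w0 x0) // mem_nth.
Qed.

(* The image of [conv_hull s `&` conv_hull t] under a map affine on [t] spans
   a space of dimension at most that spanned by [s], even though the map need
   not be affine on [s]. *)
Definition common_span M (f : 'rV[R]_N -> 'rV[R]_M) s t : 'M[R]_(N + 1, M) :=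
  (image_rows lift1 t :&: image_rows lift1 s)%MS *m
    pinvmx (image_rows lift1 t) *m image_rows f t.

Lemma rank_common_span M (f : 'rV[R]_N -> 'rV[R]_M) s t :
  (\rank (common_span f s t) <= #|` s|)%N.
Proof.
apply: leq_trans (mxrankM_maxl _ _) _; apply: leq_trans (mxrankM_maxl _ _) _.
exact: leq_trans (mxrankS (capmxSr _ _)) (rank_leq_row _).
Qed.

(** On [conv_hull t] the map [f] is [lift1] followed by a linear map: a right inverse recovers the
    barycentric coordinates, which then combine the images of the vertices. *)
Lemma sub_common_span M (f : 'rV[R]_N -> 'rV[R]_M) s t x :
  affinely_independent t -> affine_on_simplex f t ->
  conv_hull s x -> conv_hull t x -> (f x <= common_span f s t)%MS.
Proof.
move=> ti ft [a [_ a1] xs] [b bb xt].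
have lt : lift1 x = weight_row t b *m image_rows lift1 t.
  by rewrite mul_image_rows sum_lift1 -xt; case: bb => _ ->.
have ls : lift1 x = weight_row s a *m image_rows lift1 s.
  by rewrite mul_image_rows sum_lift1 -xs a1.
have : (lift1 x <= image_rows lift1 t :&: image_rows lift1 s)%MS.
  by rewrite sub_capmx {1}lt {1}ls !submxMl.
have fx : f x = lift1 x *m pinvmx (image_rows lift1 t) *m image_rows f t.
  rewrite lt -[in RHS](mulmxA (weight_row t b)) mulmxVp ?lifted_row_free //.
  by rewrite mulmx1 mul_image_rows {1}xt ft.
rewrite fx /common_span => sub.
by do 2 apply: submxMr.
Qed.

End ImageSpan.

Theorem theorem1p19 (R : realType) (n N : nat) (P : set 'rV[R]_N)
    (hn : n <> 2%N) (hP : n_polyhedron n P)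
    (hPS : pl_embeds P (pl_sphere R (2 * n)%N)) :
  exists (M : nat) (Q : set 'rV[R]_M),
    [/\ n_polyhedron n Q, k_connected (n%:Z - 1) Q, pl_embeds P Q &
        pl_embeds Q (pl_sphere R (2 * n)%N)].
Proof.
(* [K] bounds the ranks by its dimension, whereas [f] is affine on the simplices of [L] below; every
   point of [P] lies in a simplex of each. *)
have [K [_ KP] Kn] := hP; have [f [fPL finj fS]] := hPS.
have [L [[Li _ _] LP] fL] := fPL.
pose D (st : K * L) := common_span f (val st.1) (val st.2).
have neg := @functional_neg R (2 * n) _ _ D.
have coord := @functional_coord R (2 * n) _ _ D.
have [V HV] := cell_vertices_exist (functional D).
(* Simplices with at most [n.+1] vertices, that is, the n-skeleton. *)
pose S := skeleton (functional D) V n.+1.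
have SP : triangulates S (Defs.space S).
  by split=> //; exact: skeleton_complex.
have SS : Defs.space S `<=` pl_sphere R (2 * n) by exact: skeleton_sphere.
exists (2 * n).+2, (Defs.space S); split.
- by exists S => //; apply: (skeleton_dim coord HV); lia.
- split; first exact: (skeleton_nonempty coord HV).
  by move=> i x0 ile; apply: (skeleton_trivial_pi neg coord HV); lia.
- exists f; split=> // _ [x Px <-].
  have [s sK xs] : Defs.space K x by rewrite KP.
  have [t tL xt] : Defs.space L x by rewrite LP.
  have [_ ti] := Li t tL.
  apply: (rowspace_in_skeleton (j := ([` sK]%fset, [` tL]%fset)) HV).
  + apply: leq_trans (rank_common_span _ _ _) _; rewrite /= -Kn.
    exact: (@leq_bigmax_seq _ _ xpredT (fun s : {fset 'rV[R]_N} => #|` s|)).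
  + exact: sub_common_span ti (fL t tL) xs xt.
  + by apply: fS; exists x.
- exists id; split=> //; last by move=> _ [x Sx <-]; exact: SS.
  by exists S.
Qed.
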